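(* Let $\mu\in\mathbb R$, $\sigma^2>0$, let $q$ be the density of $Q=\mathcal N(\mu,\sigma^2)$ on $\mathbb R$, and let $p(w)=C/|w|$ with $C>0$ constant. Put $u:=\mu^2/(2\sigma^2)$ and $\mathrm{KL}(Q\|P):=\mathbb E_{Q}[\log q(w)]-\mathbb E_Q[\log p(w)]$. Then $$\mathrm{KL}(Q\|P)=\mathrm{const.}+\frac12\left(\log2+e^{-u}\sum_{k=0}^\infty\frac{u^k}{k!}\psi\left(\tfrac12+k\right)\right)=\mathrm{const.}-\frac12\left.\frac{\partial M(a;\tfrac12;-u)}{\partial a}\right|_{a=0},$$ where each ''const.'' denotes a constant not depending on $\mu,\sigma^2$ (the two constants may differ). In particular $\mathrm{KL}(Q\|P)$ is a function of $u\in[0,\infty)$ only. Its derivative with respect to $u$ is $$\nabla_u\,\mathrm{KL}(Q\|P)=\begin{cases}1,&u=0,\\[2pt] \dfrac{D_+(\sqrt u)}{\sqrt u},&u>0,\end{cases}$$ and this derivative is continuous in $u$ on $[0,\infty)$.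
   Context: $\psi$ is the digamma function. $M(a;b;z)=\sum_{k\ge0}\frac{(a)_k}{(b)_k}\frac{z^k}{k!}$ is Kummer's function of the first kind. $D_+(x)=e^{-x^2}\int_0^xe^{t^2}dt$ is the Dawson integral. The convention $0^0=1$ is used. The derivative at $u=0$ is one-sided. The improper density $p$ is treated formally as a density in the definition of $\mathrm{KL}$. *)

(* Defs.v *)
From mathcomp Require Export all_boot all_order all_algebra.
From mathcomp Require Export all_classical all_reals all_analysis.
Export Order.TTheory GRing.Theory Num.Theory.
Export numFieldNormedType.Exports.

Set Implicit Arguments.
Unset Strict Implicit.
Unset Printing Implicit Defensive.

Open Scope classical_set_scope.
Open Scope ring_scope.

Section special_functions.
Variable R : realType.
Implicit Types a b u x z : R.

(** Euler's integral; it represents Gamma only for [0 < x]. *)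
Definition Gamma x : R :=
  \int[lebesgue_measure]_(t in `]0, +oo[) (t `^ (x - 1) * expR (- t)).

Definition digamma x : R := Gamma^`()%classic x / Gamma x.

Definition rising_factorial a (k : nat) : R := \prod_(i < k) (a + i%:R).

(** Kummer's function of the first kind [M(a; b; z)]. *)
Definition kummerM a b z : R :=
  limn [series rising_factorial a k / rising_factorial b k * (z ^+ k / k`!%:R)]_k.

(** At most one of the two intervals has positive length, so the difference is
    the oriented integral from [0] to [x], whatever the sign of [x]. *)
Definition dawson x : R :=
  expR (- x ^+ 2) *
  (\int[lebesgue_measure]_(t in `[0, x]) expR (t ^+ 2) -
   \int[lebesgue_measure]_(t in `[x, 0]) expR (t ^+ 2)).

Definition KL_slope u : R :=
  if u == 0 then 1 else dawson (Num.sqrt u) / Num.sqrt u.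

End special_functions.

(** [KL(Q || P)] for [Q] of density [q] and a possibly improper density [p].
    A finite value forces both expectations to be finite, since [+oo] and [-oo]
    absorb finite terms and [+oo - +oo = -oo] in [\bar R]. *)
Definition KL (R : realType) (Q : probability (measurableTypeR R) R)
    (q p : R -> R) : \bar R :=
  ('E_Q[fun w => ln (q w)] - 'E_Q[fun w => ln (p w)])%E.

(** The second parameter of [normal_prob] is a square root of the variance. The
    value of [p] at [0], where the library's [_ / 0] is [0], is irrelevant. *)
Definition KL_normal (R : realType) (C mu sigma : R) : \bar R :=
  KL (normal_prob mu sigma) (normal_pdf mu sigma) (fun w => C / `|w|).

(* Main.v *)
Require Import Defs.
From mathcomp Require Import all_boot all_order all_algebra.
From mathcomp Require Import all_classical all_reals all_analysis.
From mathcomp Require Import measurable_realfun.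
From mathcomp Require Import ring lra.

(** Write [m = mu / sigma] and [u = m^2 / 2]. After rescaling, [KL] is a constant
    plus [L m], the mean of [ln |y|] under [N(m, 1)]. With
    [h m = int ln |y| exp (- y^2 / 2 + m y) dy], integrating by parts the derivative
    of [x ln x exp (- x^2 / 2 + m x)] on the half-line gives
    [(h' - m h)' = sqrt (2 pi) exp (m^2 / 2)], hence
    [L' m = exp (- m^2 / 2) int_0^m exp (s^2 / 2) ds]. The Dawson integral, the
    digamma series (through [digamma (x + 1) = digamma x + 1 / x]) and the parameter
    derivative of Kummer's function are entire functions of [u] that are matched
    with this formula by comparing derivatives with respect to [m]. The values of
    [L] at [0] and of [digamma] at [1 / 2] are absorbed by the constants. *)

Set Implicit Arguments.
Unset Strict Implicit.

(** The matching works because it is done in [m]. In [u] the series satisfy first-order equations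
    that are singular at [0], such as [W + 2 u W' = exp u] for the series [W] of [erfi_coef]. With
    [u = m^2 / 2] the left side becomes the derivative of [m W (m^2 / 2)]: this holds on the whole
    line without division, and the factor [m] makes the value at [0] trivial. Each comparison is
    then between two functions with the same derivative on [R] and the same value at [0].

    On the analytic side, integrands are unbounded near [0] and live on an infinite domain. All
    majorants reduce to [t^a exp (- t)] with [a > - 1]: completing the square replaces the Gaussian
    by [exp (- t)], and [|ln t|] is bounded by powers. The parameter always enters through a factor
    [exp (x s(y))], with [s = ln] for Gamma and [s = id] for the moments, so a single lemma on
    differentiation under the integral serves both. *)

(** * Entire series *)

Section entire_series.
Variable R : realType.
Implicit Types (c d : R^nat) (x r A B : R).

(** This growth class is stable under formal derivatives, scaling and multiplication of the
    coefficients by [k], so every convergence obligation below is met without computing a radius of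
    convergence. *)
Definition exp_bounded c := exists A B : R,
  [/\ 0 <= A, 0 <= B & forall k, `|c k| <= A * B ^+ k / k`!%:R].

Lemma exp_bounded_cvg c x : exp_bounded c -> cvgn (pseries c x).
Proof.
move=> [A [B [A0 B0 cle]]]; apply: normed_cvg.
apply: (@series_le_cvg _ _ (fun k => A * exp_coeff (B * `|x|) k)) => [k|k|k|] /=.
- exact: normr_ge0.
- by rewrite mulr_ge0// /exp_coeff/= divr_ge0 ?exprn_ge0 ?mulr_ge0.
- rewrite normrM normrX /exp_coeff/= exprMn.
  rewrite (_ : A * _ = A * B ^+ k / k`!%:R * `|x| ^+ k); last by ring.
  by apply: ler_wpM2r (cle k); exact: exprn_ge0.
- exact/is_cvg_seriesZ/is_cvg_series_exp_coeff.
Qed.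

Lemma exp_bounded_diffs c : exp_bounded c -> exp_bounded (pseries_diffs c).
Proof.
move=> [A [B [A0 B0 cle]]]; exists (A * B), B; split=> [| //|k].
  exact: mulr_ge0.
rewrite /pseries_diffs normrM ger0_norm ?ler0n//.
apply: le_trans (ler_wpM2l _ (cle k.+1)) _; first exact: ler0n.
rewrite factS natrM exprS le_eqVlt; apply/orP; left; apply/eqP; field.
by rewrite addrC natr1 !pnatr_eq0 -lt0n fact_gt0.
Qed.

Lemma exp_boundedZ r c : exp_bounded c -> exp_bounded (fun k => r * c k).
Proof.
move=> [A [B [A0 B0 cle]]]; exists (`|r| * A), B; split=> [| //|k].
  exact: mulr_ge0.
by rewrite normrM -!mulrA ler_wpM2l// mulrA.
Qed.

Lemma exp_bounded_natmul c :
  exp_bounded c -> exp_bounded (fun k => k%:R * c k).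
Proof.
move=> [A [B [A0 B0 cle]]]; exists A, (2 * B); split=> [//||k].
  exact: mulr_ge0.
rewrite normrM ger0_norm//.
rewrite (_ : A * _ / _ = 2 ^+ k * (A * B ^+ k / k`!%:R)); last first.
  by rewrite exprMn; ring.
by rewrite ler_pM// -natrX ler_nat ltnW// ltn_expl.
Qed.

Lemma exp_bounded_is_derive c x : exp_bounded c ->
  is_derive x (1 : R) (fun x => limn (pseries c x))
    (limn (pseries (pseries_diffs c) x)).
Proof.
move=> bc; apply: (@pseries_snd_diffs _ _ (`|x| + 1)).
- exact: exp_bounded_cvg.
- exact/exp_bounded_cvg/exp_bounded_diffs.
- exact/exp_bounded_cvg/exp_bounded_diffs/exp_bounded_diffs.
- by rewrite [ltRHS]ger0_norm ?ltrDl// addr_ge0.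
Qed.

Lemma cvg_pseriesD c d x : cvgn (pseries c x) -> cvgn (pseries d x) ->
  pseries (fun k => c k + d k) x @ \oo -->
    limn (pseries c x) + limn (pseries d x).
Proof.
move=> cc cd.
have -> : pseries (fun k => c k + d k) x = pseries c x \+ pseries d x.
  apply/funext => n; rewrite /pseries /series /= -big_split/=.
  by apply: eq_bigr => i _; rewrite mulrDl.
exact: cvgD.
Qed.

Lemma limn_pseriesD c d x : cvgn (pseries c x) -> cvgn (pseries d x) ->
  limn (pseries (fun k => c k + d k) x) =
  limn (pseries c x) + limn (pseries d x).
Proof. by move=> cc cd; apply/cvg_lim => //; exact: cvg_pseriesD. Qed.

Lemma limn_pseriesZ c r x : cvgn (pseries c x) ->
  limn (pseries (fun k => r * c k) x) = r * limn (pseries c x).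
Proof.
move=> cc; apply/cvg_lim => //.
have -> : pseries (fun k => r * c k) x = (fun n => r * pseries c x n).
  apply/funext => n; rewrite /pseries /series /= mulr_sumr.
  by apply: eq_bigr => i _; rewrite mulrA.
exact: cvgMr.
Qed.

(** Multiplying the coefficients by [k] is the operator [x d/dx]. Together with the index shift
    below, it turns differential equations with polynomial coefficients into recurrences on
    coefficients. *)
Lemma limn_pseries_euler c x : cvgn (pseries (pseries_diffs c) x) ->
  limn (pseries (fun k => k%:R * c k) x) =
  x * limn (pseries (pseries_diffs c) x).
Proof.
move=> cc; apply/cvg_lim => //.
have -> : pseries (fun k => k%:R * c k) x =
    (fun n => x * series (fun i => i%:R * c i * x ^+ i.-1) n).
  apply/funext => n; rewrite /pseries /series /= mulr_sumr.
  apply: eq_bigr => -[|i] _ /=; first by rewrite !mul0r mulr0.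
  by rewrite exprS; ring.
by apply: cvgMr; exact: pseries_diffs_equiv.
Qed.

Lemma limn_pseries_shift c x : cvgn (pseries (fun k => c k.+1) x) ->
  limn (pseries c x) = c 0%N + x * limn (pseries (fun k => c k.+1) x).
Proof.
move=> cc; apply/cvg_lim => //; rewrite -cvg_shiftS.
have -> : (fun n => pseries c x n.+1) =
    (fun n => c 0%N + x * pseries (fun k => c k.+1) x n).
  apply/funext => n; rewrite /pseries /series /= big_nat_recl// expr0 mulr1.
  congr (_ + _); rewrite mulr_sumr; apply: eq_bigr => i _.
  by rewrite exprS; ring.
by apply: cvgD; [exact: cvg_cst|exact: cvgMr].
Qed.

End entire_series.

(** * The three series and their differential equations *)

Section coefficients.
Variable R : realType.
Implicit Types (u m : R).

Definition psum (c : R^nat) u : R := limn (pseries c u).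

(** This is [digamma (1 / 2 + k) - digamma (1 / 2)], by [digamma_half_nat]. *)
Definition odd_harmonic k : R := \sum_(i < k) (2^-1 + i%:R)^-1.
Definition harmonic_coef k : R := odd_harmonic k / k`!%:R.
(** [m * psum erfi_coef (m ^+ 2 / 2)] is [int_0^m exp (s^2 / 2) ds]. *)
Definition erfi_coef k : R := ((k%:R * 2 + 1) * k`!%:R)^-1.
(** The coefficients of [u |-> dM/da (0; 1/2; - u)]. *)
Definition kummer_coef k : R :=
  if k is j.+1 then (-1) ^+ k * j`!%:R / (rising_factorial 2^-1 k * k`!%:R)
  else 0.

Lemma half_nat_gt0 k : 0 < 2^-1 + k%:R :> R.
Proof. by apply: ltr_wpDr => //; rewrite invr_gt0. Qed.

Lemma rising_factorialS (a : R) k :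
  rising_factorial a k.+1 = rising_factorial a k * (a + k%:R).
Proof. by rewrite /rising_factorial big_ord_recr. Qed.

Lemma rising_factorial_half_gt0 k : 0 < rising_factorial 2^-1 k :> R.
Proof. by rewrite /rising_factorial prodr_gt0// => i _; exact: half_nat_gt0. Qed.

(** The first factor of the rising factorial is [1 / 2], and each later factor [1 / 2 + i] is at
    least [i]. This cancels the factorial in the numerator of [kummer_coef]. *)
Lemma rising_factorial_half_ge k :
  k`!%:R <= 2 * rising_factorial 2^-1 k.+1 :> R.
Proof.
elim: k => [|k ih].
  by rewrite /rising_factorial big_ord1 addr0 divff// fact0.
rewrite rising_factorialS mulrA factS natrM mulrC ler_pM//.
by rewrite ler_wpDl// invr_ge0.
Qed.

Lemma fact_neq0 k : k`!%:R != 0 :> R.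
Proof. by rewrite pnatr_eq0 -lt0n fact_gt0. Qed.

Lemma exp_bounded_harmonic : exp_bounded harmonic_coef.
Proof.
(* Each summand of [odd_harmonic k] is at most [2], so the sum is at most [2 k <= 2 * 2 ^ k]. *)
exists 2, 2; split=> // k; rewrite /harmonic_coef.
rewrite normrM [X in _ * X]ger0_norm ?invr_ge0// ler_wpM2r ?invr_ge0//.
rewrite ger0_norm; last by apply: sumr_ge0 => i _; rewrite invr_ge0 ltW ?half_nat_gt0.
apply: (@le_trans _ _ (\sum_(i < k) 2)).
  apply: ler_sum => i _.
  rewrite -[leRHS]invrK lef_pV2 ?posrE ?half_nat_gt0 ?invr_gt0//.
  by rewrite lerDl.
rewrite sumr_const card_ord -[_ *+ k]mulr_natr ler_pM2l// -natrX ler_nat.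
exact/ltnW/ltn_expl.
Qed.

Lemma exp_bounded_erfi : exp_bounded erfi_coef.
Proof.
exists 1, 1; split=> // k; rewrite expr1n mul1r ger0_norm; last first.
  by rewrite invr_ge0 mulr_ge0// addr_ge0// mulr_ge0.
rewrite /erfi_coef mul1r invfM ler_piMl ?invr_ge0// invf_le1; last first.
  by rewrite ltr_wpDl// mulr_ge0.
by rewrite lerDr mulr_ge0.
Qed.

Lemma exp_bounded_kummer : exp_bounded kummer_coef.
Proof.
exists 2, 1; split=> // -[|k].
  by rewrite /kummer_coef normr0 divr_ge0.
rewrite /kummer_coef expr1n mulr1 !normrM normrX normrN1 expr1n mul1r.
have r0 := rising_factorial_half_gt0 k.+1.
rewrite !ger0_norm ?invr_ge0 ?(mulr_ge0 (ltW r0))//.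
rewrite invfM mulrA ler_wpM2r ?invr_ge0//.
rewrite ler_pdivrMr ?rising_factorial_half_gt0//.
exact: rising_factorial_half_ge.
Qed.

Let cvg_harmonic u : cvgn (pseries harmonic_coef u).
Proof. exact/exp_bounded_cvg/exp_bounded_harmonic. Qed.

Let cvg_erfi u : cvgn (pseries erfi_coef u).
Proof. exact/exp_bounded_cvg/exp_bounded_erfi. Qed.

Lemma psum_exp u : psum (fun k => (k`!%:R)^-1%R) u = expR u.
Proof. by rewrite expRE. Qed.

Lemma psum_harmonic_diffs u :
  psum (pseries_diffs harmonic_coef) u =
  psum harmonic_coef u + 2 * psum erfi_coef u.
Proof.
rewrite /psum -limn_pseriesZ// -limn_pseriesD//; last first.
  exact/exp_bounded_cvg/exp_boundedZ/exp_bounded_erfi.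
congr (limn (pseries _ u)); apply/funext => k.
rewrite /pseries_diffs /harmonic_coef /erfi_coef /odd_harmonic big_ord_recr/=.
rewrite factS natrM; field.
have := ler0n R k => h; rewrite fact_neq0 /=.
by apply/andP; split; rewrite gt_eqF//; lra.
Qed.

(** On coefficients this reads [(2 k + 1) * erfi_coef k = 1 / k!]. *)
Lemma psum_erfi_diffs u :
  psum erfi_coef u + 2 * (u * psum (pseries_diffs erfi_coef) u) = expR u.
Proof.
have b := exp_bounded_natmul exp_bounded_erfi.
rewrite /psum -limn_pseries_euler; last first.
  exact/exp_bounded_cvg/exp_bounded_diffs/exp_bounded_erfi.
rewrite -limn_pseriesZ; last exact/exp_bounded_cvg.
rewrite -limn_pseriesD//; last exact/exp_bounded_cvg/exp_boundedZ.
rewrite -psum_exp; congr (limn (pseries _ u)); apply/funext => k.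
rewrite /erfi_coef; field; rewrite fact_neq0 /=.
by have := ler0n R k => h; rewrite gt_eqF//; lra.
Qed.

Lemma kummer_coef_diffs k : pseries_diffs kummer_coef k =
  (-1) ^+ k.+1 / rising_factorial 2^-1 k.+1.
Proof.
rewrite /pseries_diffs /kummer_coef factS natrM; field.
have := rising_factorial_half_gt0 k.+1.
by rewrite fact_neq0 addrC natr1 pnatr_eq0 /= => h; rewrite gt_eqF.
Qed.

Lemma psum_kummer_diffs u (D := pseries_diffs kummer_coef) :
  (1 + 2 * u) * psum D u + 2 * (u * psum (pseries_diffs D) u) = - 2.
Proof.
have bD : exp_bounded D by exact/exp_bounded_diffs/exp_bounded_kummer.
have bnD := exp_bounded_natmul bD.
have cD := @exp_bounded_cvg _ _ u bD.
(* [E] holds the coefficients of [D + 2 u D']. Since [2 k + 3] is twice the last factor of the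
   rising factorial in [D (k + 1)], shifting [E] gives back [- 2 D], and [E 0 = - 2] is the
   right-hand side. *)
pose E k := D k + 2 * (k%:R * D k).
have ES k : E k.+1 = (- 2) * D k.
  rewrite /E /D !kummer_coef_diffs exprS [in LHS]rising_factorialS.
  have := rising_factorial_half_gt0 k.+1 => h.
  have h2 := half_nat_gt0 k.+1; rewrite -natr1; rewrite -natr1 in h2.
  by field; rewrite !gt_eqF//; lra.
have : limn (pseries E u) = psum D u + 2 * (u * psum (pseries_diffs D) u).
  rewrite /psum -limn_pseries_euler; last exact/exp_bounded_cvg/exp_bounded_diffs.
  rewrite -limn_pseriesZ; last exact/exp_bounded_cvg.
  rewrite -limn_pseriesD//; exact/exp_bounded_cvg/exp_boundedZ.
rewrite limn_pseries_shift; last first.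
  by under eq_fun do rewrite ES; exact/exp_bounded_cvg/exp_boundedZ.
under [in X in limn X]eq_fun do rewrite ES.
rewrite limn_pseriesZ// /E mul0r mulr0 addr0 {1}/D kummer_coef_diffs.
rewrite rising_factorialS /rising_factorial big_ord0 mul1r addr0 expr1 invrK.
rewrite /psum => e; lra.
Qed.

Lemma is_derive_half_sqr m : is_derive m 1 (fun x : R => x ^+ 2 / 2) m.
Proof.
by apply: is_derive_eq; rewrite /GRing.scale/=; field.
Qed.

Lemma is_derive_comp_half_sqr (F : R -> R) m d :
  is_derive (m ^+ 2 / 2) 1 F d ->
  is_derive m 1 (fun x => F (x ^+ 2 / 2)) (d * m).
Proof.
by move=> dF; apply: (@is_derive1_comp _ F _ m d m) => //;
  exact: is_derive_half_sqr.
Qed.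

(** The derivative of the divergence in [u], as an entire function; [KL_slopeE] identifies it with
    the Dawson quotient. *)
Definition kl_slope u : R := expR (- u) * psum erfi_coef u.
(** The digamma series of the theorem, with [digamma (1 / 2)] subtracted from each digamma value. *)
Definition kl_sum u : R := expR (- u) * psum harmonic_coef u.

Lemma is_derive_kl_sum u : is_derive u 1 kl_sum (2 * kl_slope u).
Proof.
have dS := exp_bounded_is_derive u exp_bounded_harmonic.
rewrite -/(psum _) in dS.
have dE : is_derive u 1 (fun x : R => expR (- x)) (- expR (- u)).
  by apply: is_derive_eq; rewrite mulrN1.
apply: is_derive_eq; rewrite -/(psum _ _) psum_harmonic_diffs /kl_slope.
by rewrite /GRing.scale/=; ring.
Qed.

Lemma is_derive_erfi m :
  is_derive m 1 (fun x => x * psum erfi_coef (x ^+ 2 / 2)) (expR (m ^+ 2 / 2)).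
Proof.
have dW := is_derive_comp_half_sqr
  (exp_bounded_is_derive (m ^+ 2 / 2) exp_bounded_erfi).
apply: is_derive_eq; rewrite -/(psum _ _) -psum_erfi_diffs /GRing.scale/=.
by rewrite /psum; field.
Qed.

Lemma is_derive_kummer m : is_derive m 1
  (fun x => expR (x ^+ 2 / 2) * (x * psum (pseries_diffs kummer_coef) (x ^+ 2 / 2)))
  (- 2 * expR (m ^+ 2 / 2)).
Proof.
have dD := is_derive_comp_half_sqr
  (exp_bounded_is_derive (m ^+ 2 / 2) (exp_bounded_diffs exp_bounded_kummer)).
have dE := is_derive_comp_half_sqr (is_derive_expR (m ^+ 2 / 2)).
apply: is_derive_eq; rewrite -/(psum _ _) -(psum_kummer_diffs (m ^+ 2 / 2)).
by rewrite /psum /GRing.scale/=; field.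
Qed.

Lemma eq_of_is_derive (f g df : R -> R) : f 0 = g 0 ->
  (forall x : R, is_derive x 1 f (df x)) ->
  (forall x : R, is_derive x 1 g (df x)) ->
  f =1 g.
Proof.
move=> fg0 dff dg x; apply/eqP; rewrite -subr_eq0.
have d0 (y : R) : is_derive y 1 (fun x => f x - g x) 0.
  by apply: is_derive_eq; rewrite subrr.
by rewrite (is_derive_0_is_cst x 0 d0) fg0 subrr.
Qed.

Lemma psum0 c : exp_bounded c -> psum c 0 = c 0%N.
Proof.
move=> [A [B [A0 B0 cle]]]; apply/cvg_lim => //; rewrite -cvg_shiftS.
have -> : (fun n => pseries c 0 n.+1) = cst (c 0%N).
  apply/funext => n; rewrite /pseries /series /= big_nat_recl// expr0 mulr1.
  by rewrite big1 ?addr0// => i _; rewrite expr0n mulr0.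
exact: cvg_cst.
Qed.

Lemma kl_sum_half_sqr m :
  psum kummer_coef (m ^+ 2 / 2) = - kl_sum (m ^+ 2 / 2).
Proof.
have h0 : (0 : R) ^+ 2 / 2 = 0 by rewrite expr0n mul0r.
(* The factor [x] is kept on both sides: it is the one that the chain rule for [x ^+ 2 / 2]
   produces, so the case [x = 0] needs no separate treatment. *)
have E x : x * psum (pseries_diffs kummer_coef) (x ^+ 2 / 2) =
    - 2 * (x * kl_slope (x ^+ 2 / 2)).
  have : expR (x ^+ 2 / 2) * (x * psum (pseries_diffs kummer_coef) (x ^+ 2 / 2)) =
      - 2 * (x * psum erfi_coef (x ^+ 2 / 2)).
    move: x; apply: eq_of_is_derive.
    - by rewrite !mul0r !mulr0.
    - exact: is_derive_kummer.
    - move=> x; have := is_derive_erfi x => h.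
      by apply: is_derive_eq; rewrite /GRing.scale/=; ring.
  rewrite /kl_slope expRN => e.
  apply: (mulfI (lt0r_neq0 (expR_gt0 (x ^+ 2 / 2)))); rewrite e.
  by field; rewrite expR_eq0.
move: m; apply: eq_of_is_derive.
- rewrite h0 /kl_sum oppr0 expR0 mul1r !psum0.
  + by rewrite /harmonic_coef /odd_harmonic big_ord0 mul0r oppr0.
  + exact: exp_bounded_harmonic.
  + exact: exp_bounded_kummer.
- move=> x; apply: is_derive_comp_half_sqr.
  exact: exp_bounded_is_derive exp_bounded_kummer.
- move=> x; have := is_derive_comp_half_sqr (is_derive_kl_sum (x ^+ 2 / 2)) => h.
  apply: is_derive_eq; rewrite -/(psum _ _) [RHS]mulrC E; ring.
Qed.

End coefficients.

(** * Lebesgue integrals *)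

Section half_line.
Local Open Scope ring_scope.
Variable R : realType.
Implicit Types (f F : R -> R).
Local Notation mu := (@lebesgue_measure R).
Local Notation Rpos := (`]0%R, +oo[%classic : set R).

(** Compact intervals exhausting the half-line, so that the fundamental theorem applies away from
    the singularity at [0]. The shift by two keeps them nondegenerate from [n = 0] on. *)
Let J n : set R := `[(n.+2%:R^-1)%R, n.+2%:R%R]%classic.

Let J_lt n : n.+2%:R^-1 < n.+2%:R :> R.
Proof. by apply: (@lt_trans _ _ 1); rewrite ?invf_lt1 ?ltr1n. Qed.

Let J_gt0 n x : J n x -> 0 < x.
Proof. by rewrite /J/= in_itv/= => /andP[+ _]; apply: lt_le_trans; rewrite invr_gt0. Qed.

Let J_Rpos n : J n `<=` Rpos.
Proof. by move=> x /J_gt0; rewrite /= in_itv/= andbT. Qed.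

Lemma measurable_fun_Rpos f : (forall x : R, 0 < x -> {for x, continuous f}) ->
  measurable_fun Rpos f.
Proof.
move=> cf; apply: open_continuous_measurable_fun; first exact: interval_open.
by move=> x; rewrite inE/= in_itv/= andbT; exact: cf.
Qed.

Let FTC_J f F n : (forall x : R, 0 < x -> {for x, continuous f}) ->
  (forall x : R, 0 < x -> is_derive x 1 F (f x)) ->
  (\int[mu]_(x in J n) (f x)%:E = (F n.+2%:R - F n.+2%:R^-1)%:E)%E.
Proof.
move=> cf dF.
have cF x : 0 < x -> {for x, continuous F}.
  by move=> /dF d; apply/differentiable_continuous/derivable1_diffP.
rewrite (@continuous_FTC2 _ f F) ?EFinB//.
- apply/continuous_in_subspaceT => x; rewrite inE => xJ.
  by apply: cf; exact: J_gt0 xJ.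
- split.
  + move=> x xJ; suff /dF[] : 0 < x by [].
    by apply: (@J_gt0 n); exact: subset_itv_oo_cc.
  + apply: cvg_at_right_filter; apply: cF; by rewrite invr_gt0.
  + apply: cvg_at_left_filter; exact: cF.
- move=> x xJ; have /dF[_ <-] : 0 < x.
    by apply: (@J_gt0 n); exact: subset_itv_oo_cc.
  by rewrite derive1E.
Qed.

Let cvg_J f x : Rpos x ->
  ((EFin \o f) \_ (J n) x @[n --> \oo] --> (f x)%:E)%E.
Proof.
rewrite /= in_itv/= andbT => x0; apply: cvg_near_cst; near=> n.
rewrite patchE mem_set//= /J/= in_itv/=; apply/andP; split.
  rewrite -[leRHS]invrK lef_pV2 ?posrE ?invr_gt0//.
  apply: (@le_trans _ _ n%:R); last by rewrite ler_nat !leqW.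
  by near: n; exact: nbhs_infty_ger.
apply: (@le_trans _ _ n%:R); last by rewrite ler_nat !leqW.
by near: n; exact: nbhs_infty_ger.
Unshelve. all: by end_near. Qed.

Let mfJ f n : measurable_fun Rpos f ->
  measurable_fun Rpos (fun x : R => ((EFin \o f) \_ (J n)) x : \bar R).
Proof.
move=> mf; apply/measurable_restrict => //; first exact: measurable_itv.
apply: (@measurable_funS _ _ _ _ Rpos) => //.
exact/measurable_EFinP.
Qed.

Let integral_J f n : (\int[mu]_(x in Rpos) ((EFin \o f) \_ (J n)) x =
  \int[mu]_(x in J n) (f x)%:E)%E.
Proof. by rewrite -integral_mkcondr setIidr//; exact: J_Rpos. Qed.

(** The integral over [J n] is a difference of two values of [F], at most [2 M]; monotone
    convergence passes this bound to the half-line. *)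
Lemma integrable_Rpos_bounded_primitive f F (M : R) :
  (forall x : R, 0 < x -> {for x, continuous f}) ->
  (forall x : R, 0 < x -> 0 <= f x) ->
  (forall x : R, 0 < x -> is_derive x 1 F (f x)) ->
  (forall x : R, 0 < x -> `|F x| <= M) ->
  mu.-integrable Rpos (EFin \o f).
Proof.
move=> cf f0 dF FM; have mf := measurable_fun_Rpos cf.
have Rpos0 x : Rpos x -> 0 < x by rewrite /= in_itv/= andbT.
apply/integrableP; split; first exact/measurable_EFinP.
under eq_integral => x /[!inE] /Rpos0 x0 do rewrite /= ger0_norm ?f0//.
have : (\int[mu]_(x in Rpos) ((EFin \o f) \_ (J n)) x @[n --> \oo] -->
    \int[mu]_(x in Rpos) (f x)%:E)%E.
  have -> : (\int[mu]_(x in Rpos) (f x)%:E =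
      \int[mu]_(x in Rpos) limn (fun n => ((EFin \o f) \_ (J n)) x : \bar R))%E.
    by apply: eq_integral => x /[!inE] xD; apply/esym/cvg_lim => //; exact: cvg_J.
  apply: cvg_monotone_convergence => //.
    - by move=> n; exact: mfJ.
    - move=> n x /Rpos0 x0; rewrite patchE; case: ifPn => //= _.
      by rewrite lee_fin f0.
    - move=> x /Rpos0 x0 m n mn; rewrite !patchE; case: ifPn => [|_].
        rewrite inE /J/= in_itv/= => /andP[h1 h2].
        rewrite mem_set//= in_itv/=; apply/andP; split.
          by rewrite (le_trans _ h1)// lef_pV2 ?posrE// ler_nat !ltnS.
        by rewrite (le_trans h2)// ler_nat !ltnS.
      by case: ifPn => //= _; rewrite lee_fin f0.
under eq_fun do rewrite integral_J FTC_J//.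
move=> h; rewrite -(cvg_lim _ h)//.
apply: (@le_lt_trans _ _ (M + M)%:E); last exact: ltry.
apply: lime_le; first by apply/cvg_ex; eexists; exact: h.
near=> n; rewrite lee_fin (le_trans (ler_norm _))// (le_trans (ler_normB _ _))//.
by rewrite lerD ?FM// invr_gt0.
Unshelve. all: by end_near. Qed.

(** Dominated convergence along [J n], with [|f|] itself as the majorant. *)
Lemma Rintegral_Rpos_FTC f F (a b : R) :
  (forall x : R, 0 < x -> {for x, continuous f}) ->
  (forall x : R, 0 < x -> is_derive x 1 F (f x)) ->
  mu.-integrable Rpos (EFin \o f) ->
  F x @[x --> 0^'+] --> a -> F x @[x --> +oo] --> b ->
  \int[mu]_(x in Rpos) f x = b - a.
Proof.
move=> cf dF intf Fa Fb; have mf := measurable_fun_Rpos cf.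
have [||||||_ _] := @dominated_convergence _ _ _ mu Rpos _
  (fun n => (EFin \o f) \_ (J n)) (EFin \o f) (abse \o (EFin \o f)).
- by [].
- by move=> n; exact: mfJ.
- exact/measurable_EFinP.
- by apply: aeW => x; exact: cvg_J.
- exact: integrable_abse.
- apply: aeW => x n _; rewrite patchE; case: ifPn => //= _.
  by rewrite lee_fin normr0.
rewrite /=; under eq_fun do rewrite integral_J FTC_J//.
move=> h; rewrite /Rintegral -(cvg_lim _ h)//.
rewrite (_ : limn _ = (b - a)%:E)//; apply/cvg_lim => //.
apply: cvg_EFin; first exact: nearW.
apply: cvgB.
  apply: (cvg_comp (fun n => n.+2%:R : R) F) Fb.
  apply/cvgryPge => r; near=> n; apply: (@le_trans _ _ n%:R).
    by near: n; exact: nbhs_infty_ger.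
  by rewrite ler_nat !leqW.
apply: (cvg_comp (fun n => n.+2%:R^-1 : R) F) Fa.
have h0 : n.+2%:R^-1 @[n --> \oo] --> (0 : R).
  by have := @cvg_harmonic R; rewrite -cvg_shiftS.
move=> P [e /= e0 he]; rewrite /= nbhs_filterE.
have /cvgr0Pnorm_lt/(_ e e0) h1 := h0.
near=> n; apply: he => /=; last by rewrite invr_gt0.
by rewrite sub0r normrN; near: n.
Unshelve. all: by end_near. Qed.

Lemma Rintegral_Rpos_eq0 f F (C e : R) : 0 < e ->
  (forall x : R, 0 < x -> {for x, continuous f}) ->
  (forall x : R, 0 < x -> is_derive x 1 F (f x)) ->
  mu.-integrable Rpos (EFin \o f) ->
  (forall x : R, 0 < x -> `|F x| <= C * x `^ e) ->
  (forall x : R, 0 < x -> `|F x| <= C / x) ->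
  \int[mu]_(x in Rpos) f x = 0.
Proof.
move=> e0 cf dF intf F0 Fy.
rewrite (@Rintegral_Rpos_FTC f F 0 0) ?subrr//.
- apply: norm_cvg0; apply: (@squeeze_cvgr _ _ _ _ (cst 0) (fun x => C * x `^ e)).
  + by near=> x; rewrite /= normr_ge0 F0.
  + exact: cvg_cst.
  + rewrite -[X in _ --> X](mulr0 C); apply: cvgMr; exact: powR_cvg0.
- apply: norm_cvg0; apply: (@squeeze_cvgr _ _ _ _ (cst 0) (fun x => C / x)).
  + by near=> x; rewrite /= normr_ge0 Fy.
  + exact: cvg_cst.
  + rewrite -[X in _ --> X](mulr0 C); apply: cvgMr; apply/gtr0_cvgV0; last exact: cvg_id.
    exact: nbhs_pinfty_gt.
Unshelve. all: by end_near. Qed.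

End half_line.

(** * Differentiation under the integral in an exponential family *)

Section exponential_family.
Local Open Scope ring_scope.
Context (R : realType) (d : measure_display) (T : measurableType d).
Variables (mu : {measure set T -> \bar R}) (D : set T) (g s : T -> R).
Hypotheses (mD : measurable D) (mg : measurable_fun D g)
  (ms : measurable_fun D s).
Variables (x0 r : R).
Hypothesis r_gt0 : 0 < r.
Hypotheses
  (int_l : mu.-integrable D (fun y => (g y * expR ((x0 - r) * s y))%:E))
  (int_r : mu.-integrable D (fun y => (g y * expR ((x0 + r) * s y))%:E)).

(** A majorant of the parameter derivative for [|x - x0| <= r / 2]. By monotonicity of [x * s y] in
    [x], the exponential is below one of its two endpoint values, whatever the sign of [s y];
    integrability at the two endpoints is therefore all that is assumed. *)
Let dom y := 2 / r * `|g y| * (expR ((x0 - r) * s y) + expR ((x0 + r) * s y)).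

Let mexp (x : R) : measurable_fun D (fun y => expR (x * s y)).
Proof. by apply: measurableT_comp => //; exact: measurable_funM. Qed.

Let int_dom : mu.-integrable D (EFin \o dom).
Proof.
have := integrableZl mD (2 / r)
  (integrableD mD (integrable_abse int_l) (integrable_abse int_r)).
apply: eq_integrable => // y _; rewrite /dom /= !normrM.
by rewrite !(ger0_norm (expR_ge0 _)) -EFinD -EFinM -mulrDr mulrA.
Qed.

Let exp_le x y : `|x - x0| <= r ->
  expR (x * s y) <= expR ((x0 - r) * s y) + expR ((x0 + r) * s y).
Proof.
rewrite ler_norml => /andP[h1 h2].
have [s0|/ltW s0] := lerP 0 (s y).
  by rewrite ler_wpDl ?expR_ge0// ler_expR ler_wpM2r//; lra.
by rewrite ler_wpDr ?expR_ge0// ler_expR ler_wnM2r//; lra.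
Qed.

(* [|s| <= (2 / r) exp (r |s| / 2)]: half of the room [r] pays for the factor [s]. *)
Let sexp_le x y : `|x - x0| <= r / 2 ->
  `|s y| * expR (x * s y) <=
    2 / r * (expR ((x0 - r) * s y) + expR ((x0 + r) * s y)).
Proof.
rewrite ler_norml => /andP[h1 h2].
have r20 : 0 < r / 2 by rewrite divr_gt0.
have sle : `|s y| <= 2 / r * expR (r / 2 * `|s y|).
  rewrite -(ler_pM2l r20) mulrA.
  rewrite (_ : r / 2 * (2 / r) = 1) ?mul1r; last by field; rewrite gt_eqF.
  by apply: le_trans (expR_ge1Dx _); rewrite lerDr.
apply: (le_trans (ler_wpM2r (expR_ge0 _) sle)).
rewrite -(mulrA (2 / r)) ler_wpM2l ?divr_ge0 ?(ltW r_gt0)// -expRD.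
have [s0|/ltW s0] := lerP 0 (s y).
  rewrite ger0_norm// -mulrDl ler_wpDl ?expR_ge0// ler_expR ler_wpM2r//; lra.
rewrite ler0_norm// mulrN -mulNr -mulrDl ler_wpDr ?expR_ge0// ler_expR.
rewrite ler_wnM2r//; lra.
Qed.

Lemma integrable_exp_family x : `|x - x0| <= r ->
  mu.-integrable D (fun y => (g y * expR (x * s y))%:E).
Proof.
move=> xr.
have := integrableD mD (integrable_abse int_l) (integrable_abse int_r).
apply: le_integrable => //.
  by apply/measurable_EFinP/measurable_funM.
move=> y Dy; rewrite /= !lee_fin !normrM !(ger0_norm (expR_ge0 _)) -mulrDr.
rewrite [leRHS]ger0_norm ?mulr_ge0 ?addr_ge0 ?expR_ge0//.
by rewrite ler_wpM2l// exp_le.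
Qed.

Let is_derive_integrand y (x : R) :
  is_derive x 1 (fun x => g y * expR (x * s y)) (g y * s y * expR (x * s y)).
Proof.
by apply: is_derive_eq; rewrite /GRing.scale/=; ring.
Qed.

Lemma is_derive_exp_family :
  is_derive x0 1 (fun x => \int[mu]_(y in D) (g y * expR (x * s y)))
    (\int[mu]_(y in D) (g y * s y * expR (x0 * s y))).
Proof.
have r20 : 0 < r / 2 by rewrite divr_gt0.
pose f (x : R) y := g y * expR (x * s y).
have Ix0 : `]x0 - r / 2, x0 + r / 2[%classic x0.
  by rewrite /= in_itv/= ltrBlDr !ltrDl r20.
have Inorm x : `]x0 - r / 2, x0 + r / 2[%classic x -> `|x - x0| <= r / 2.
  by rewrite /= in_itv/= ler_norml => /andP[h1 h2]; apply/andP; split; lra.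
have intf x : `]x0 - r / 2, x0 + r / 2[%classic x ->
    mu.-integrable D (EFin \o f x).
  move=> /Inorm xr; apply: integrable_exp_family.
  by apply: (le_trans xr); lra.
have derf x y : `]x0 - r / 2, x0 + r / 2[%classic x -> D y ->
    derivable (f ^~ y) x 1 by move=> _ _; have [] := is_derive_integrand y x.
have fE x y : partial1of2 f x y = g y * s y * expR (x * s y).
  by rewrite partial1of2E; have [_ <-] := is_derive_integrand y x.
have dom0 y : 0 <= dom y.
  by rewrite /dom !mulr_ge0 ?addr_ge0 ?expR_ge0 ?invr_ge0// ltW.
have domP x y : `]x0 - r / 2, x0 + r / 2[%classic x -> D y ->
    `|partial1of2 f x y| <= dom y.
  move=> /Inorm xr Dy; rewrite fE /dom !normrM (ger0_norm (expR_ge0 _)).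
  by rewrite -mulrA [_ / r * _]mulrC -mulrA ler_wpM2l// sexp_le.
have F1 := derivable_under_integral mD Ix0 intf derf dom0 int_dom domP.
have F2 := differentiation_under_integral mD Ix0 intf derf dom0 int_dom domP.
split; first exact: F1.
rewrite -derive1E F2; apply: eq_Rintegral => y _; exact: fE.
Qed.

End exponential_family.

(** * Change of measure and affine change of variable *)

Section integral_transfer.
Local Open Scope ring_scope.
Context (R : realType).
Local Notation mu := (@lebesgue_measure R).

(** A nonnegative weight commutes with positive and negative parts, and the integral is by
    definition the difference of the two. So the identity extends to signed functions with no
    integrability condition, in extended reals. *)
Lemma integral_transfer_signed (P1 P2 : {measure set (measurableTypeR R) -> \bar R})
    (w phi : R -> R) : (forall x, 0 <= w x) ->
  (forall f : R -> R, measurable_fun setT f -> (forall x, 0 <= f x) ->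
    (\int[P1]_x (f x)%:E = \int[P2]_x (w x * f (phi x))%:E)%E) ->
  forall f : R -> R, measurable_fun setT f ->
    (\int[P1]_x (f x)%:E = \int[P2]_x (w x * f (phi x))%:E)%E.
Proof.
move=> w0 tr f mf; rewrite integralE [RHS]integralE; congr (_ - _)%E.
- transitivity (\int[P1]_x (Num.max (f x) 0)%:E)%E.
    by apply: eq_integral => x _; rewrite funeposE EFin_max.
  rewrite tr => [|| x]; last by rewrite le_max lexx orbT.
    apply: eq_integral => x _; rewrite funeposE -EFin_max.
    by rewrite maxr_pMr// mulr0.
  exact: measurable_maxr.
- transitivity (\int[P1]_x (Num.max (- f x) 0)%:E)%E.
    by apply: eq_integral => x _; rewrite funenegE EFin_max.
  rewrite tr => [|| x]; last by rewrite le_max lexx orbT.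
    apply: eq_integral => x _; rewrite funenegE -EFinN -EFin_max.
    by rewrite maxr_pMr// mulr0 mulrN.
  by apply: measurable_maxr => //; exact: measurableT_comp.
Qed.

Lemma integral_normal_prob (m s : R) (f : R -> R) : measurable_fun setT f ->
  (\int[normal_prob m s]_x (f x)%:E =
   \int[mu]_x (normal_pdf m s x * f x)%:E)%E.
Proof.
apply: (@integral_transfer_signed _ _ (normal_pdf m s) id).
  exact: normal_pdf_ge0.
move=> {}f mf f0.
have dom := normal_prob_dominates m s.
rewrite -(Radon_Nikodym_SigmaFinite.change_of_variables dom)//; last first.
  exact/measurable_EFinP.
apply: ae_eq_integral => //.
- apply: emeasurable_funM; first exact/measurable_EFinP.
  exact: measurable_int (Radon_Nikodym_SigmaFinite.f_integrable dom).
- apply/measurable_EFinP/measurable_funM => //; exact: measurable_normal_pdf.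
(* Both densities have the same integral over every measurable set, namely its normal probability,
   so they agree almost everywhere. *)
have h : ae_eq mu setT (Radon_Nikodym_SigmaFinite.f (normal_prob m s) mu)
    (EFin \o normal_pdf m s).
  apply: integral_ae_eq => //.
  - exact: Radon_Nikodym_SigmaFinite.f_integrable.
  - by apply/measurable_EFinP; exact: measurable_normal_pdf.
  - by move=> E _ mE; rewrite -Radon_Nikodym_SigmaFinite.f_integral.
apply: filterS h => x /= h _; rewrite h// -EFinM mulrC; congr EFin.
Qed.

Lemma lebesgue_measure_affine (s m : R) (s0 : 0 < s) (A : set R) :
  measurable A -> (s%:E * mu ((fun x => (s * x + m)%R) @^-1` A))%E = mu A.
Proof.
have mphi : measurable_fun setT ((fun x : R => s * x + m) : R -> measurableTypeR R).
  by apply: measurable_funD => //; exact: measurable_funM.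
pose nu := mscale (NngNum (ltW s0))
  (pushforward mu ((fun x => s * x + m) : R -> measurableTypeR R)).
rewrite -[LHS]/(nu mphi A) /nu.
move=> mA; apply/esym/lebesgue_measure_unique => //= _ [[a b]] _ <-.
rewrite /mscale /pushforward /=.
rewrite [X in (_ * lebesgue_measure X)%E](_ : _ =
    `](a - m) / s, (b - m) / s]%classic); last first.
  have eqv (x : R) :
      (a < s * x + m <= b) = ((a - m) / s < x <= (b - m) / s).
    by rewrite ltr_pdivrMr// ler_pdivlMr// ltrBlDr lerBrDr [x * s]mulrC.
  by apply/seteqP; split => x; rewrite /= !in_itv/= eqv.
rewrite !lebesgue_measure_itv/= !lte_fin ltr_pM2r ?invr_gt0// ltrD2r.
case: ifPn => _; last by rewrite mule0.
by rewrite -!EFinB -EFinM; congr EFin; field; rewrite gt_eqF.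
Qed.

Lemma integral_affine (s m : R) (f : R -> R) : 0 < s ->
  measurable_fun setT f ->
  (\int[mu]_x (f x)%:E = \int[mu]_x (s * f (s * x + m))%:E)%E.
Proof.
move=> s0; apply: (@integral_transfer_signed _ _ (cst s) (fun x => s * x + m)).
  by move=> x; rewrite ltW.
move=> {}f mf f0 /=.
have mphi : measurable_fun setT ((fun x : R => s * x + m) : R -> measurableTypeR R).
  by apply: measurable_funD => //; exact: measurable_funM.
under [RHS]eq_integral do rewrite EFinM.
rewrite ge0_integralZl//; last 3 first.
- by apply/measurable_EFinP; exact: measurableT_comp.
- by move=> x _; rewrite lee_fin.
- by rewrite lee_fin ltW.
have := @ge0_integral_pushforward _ _ (measurableTypeR R) (measurableTypeR R) R
  _ mphi lebesgue_measure setT (EFin \o f) measurableT.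
rewrite preimage_setT => <-; last 2 first.
- exact/measurable_EFinP.
- by move=> x _ /=; rewrite lee_fin.
rewrite -(@ge0_integral_mscale _ _ _ _ setT _ (NngNum (ltW s0)))//.
- by apply: eq_measure_integral => A mA _; exact: esym (lebesgue_measure_affine m s0 mA).
- exact/measurable_EFinP.
- by move=> x _ /=; rewrite lee_fin.
Qed.

End integral_transfer.

(** * Gamma and digamma functions *)

Section gamma_function.
Local Open Scope ring_scope.
Variable R : realType.
Implicit Types (f g : R -> R) (a t x : R).
Local Notation mu := (@lebesgue_measure R).
Local Notation Rpos := (`]0%R, +oo[%classic : set R).

Lemma is_derive_continuous f x df : is_derive x 1 f df -> {for x, continuous f}.
Proof. by move=> d; apply/differentiable_continuous/derivable1_diffP. Qed.

Lemma exprn_expRN_le n t : 0 <= t -> t ^+ n * expR (- t) <= n`!%:R.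
Proof.
move=> t0; rewrite expRN ler_pdivrMr ?expR_gt0//; case: n => [|n].
  by rewrite expr0 fact0 mul1r (le_trans _ (expR_ge1Dx t))// lerDl.
rewrite mulrC -ler_pdivrMr ?ltr0n ?fact_gt0//.
by apply: le_trans (expR_ge1Dxn n t0); rewrite lerDr.
Qed.

Lemma powR_expRN_le a : 0 <= a ->
  exists2 C : R, 0 <= C & forall t, 0 < t -> t `^ a * expR (- t) <= C.
Proof.
(* The [1] covers [t <= 1]. For [t >= 1] the exponent is raised to the integer [Num.bound a], where
   [t^n / n! <= exp t] applies. *)
move=> a0; exists (1 + (Num.bound a)`!%:R) => [|t t0]; first by rewrite addr_ge0.
have t0' := ltW t0.
have e1 : expR (- t) <= 1 by rewrite expR_le1 oppr_le0.
have [t1|/ltW t1] := lerP t 1.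
  apply: (@le_trans _ _ 1); last by rewrite lerDl.
  have := @ge0_ler_powR _ a a0 t 1; rewrite !nnegrE powR1 => h.
  by rewrite mulr_ile1 ?powR_ge0 ?expR_ge0 ?h.
apply: (@le_trans _ _ (t ^+ Num.bound a * expR (- t))).
  rewrite ler_wpM2r ?expR_ge0// -powR_mulrn// ler_powR//.
  exact: ltW (archi_boundP a0).
by apply: (le_trans (exprn_expRN_le _ t0')); rewrite lerDr.
Qed.

Lemma integrable_Rpos_le f g (C : R) : measurable_fun Rpos f ->
  mu.-integrable Rpos (EFin \o g) ->
  (forall t, 0 < t -> `|f t| <= C * g t) -> mu.-integrable Rpos (EFin \o f).
Proof.
move=> mf ig fg.
have : mu.-integrable Rpos (fun t => C%:E * (g t)%:E)%E by exact: integrableZl.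
apply: le_integrable => //; first exact/measurable_EFinP.
move=> t; rewrite /= in_itv/= andbT => t0; rewrite lee_fin.
by apply: le_trans (ler_norm _); exact: fg.
Qed.

Lemma integrable_RposD f g : mu.-integrable Rpos (EFin \o f) ->
  mu.-integrable Rpos (EFin \o g) ->
  mu.-integrable Rpos (EFin \o (fun t => f t + g t)).
Proof. by move=> i j; have := integrableD _ i j; apply; exact: measurable_itv. Qed.

Lemma integrable_RposB f g : mu.-integrable Rpos (EFin \o f) ->
  mu.-integrable Rpos (EFin \o g) ->
  mu.-integrable Rpos (EFin \o (fun t => f t - g t)).
Proof. by move=> i j; have := integrableB _ i j; apply; exact: measurable_itv. Qed.

Lemma integrable_RposZ a f : mu.-integrable Rpos (EFin \o f) ->
  mu.-integrable Rpos (EFin \o (fun t => a * f t)).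
Proof. by move=> i; have := integrableZl _ a i; apply; exact: measurable_itv. Qed.

Lemma continuous_powR_expRN a t : 0 < t ->
  {for t, continuous (fun t => t `^ a * expR (- t))}.
Proof.
move=> t0; have d := is_derive1_powR a t0.
by apply: is_derive_continuous.
Qed.

(** Comparison with the derivative of the bounded function [- 1 / (1 + t^(a + 1))]. *)
Lemma integrable_powR_expRN a : - 1 < a ->
  mu.-integrable Rpos (fun t => (t `^ a * expR (- t))%:E).
Proof.
move=> a1; pose b := a + 1; have b0 : 0 < b by rewrite /b; lra.
have [C C0 hC] := powR_expRN_le (ltW (mulr_gt0 (ltr0n R 2) b0)).
have p0 t : 0 < 1 + t `^ b by rewrite ltr_wpDr ?powR_ge0.
pose f t := (1 + t `^ b)^-1 * (1 + t `^ b)^-1 * (b * t `^ (b - 1)).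
pose F t := - (1 + t `^ b)^-1.
have dF t : 0 < t -> is_derive t 1 F (f t).
  move=> t0; have d := is_derive1_powR b t0.
  have d1 : is_derive t 1 (fun t => 1 + t `^ b) (b * t `^ (b - 1)).
    by have := is_deriveD (is_derive_cst (1 : R) t 1) d; rewrite add0r.
  have d2 := @is_deriveV _ (fun t => 1 + t `^ b) t _ 1 (lt0r_neq0 (p0 t)) d1.
  apply: (is_derive_eq (is_deriveN d2)); rewrite /f /GRing.scale/=.
  by field; rewrite gt_eqF.
have cf t : 0 < t -> {for t, continuous f}.
  move=> t0; have cF : {for t, continuous (fun t => (1 + t `^ b)^-1)}.
    apply: continuousV; first by rewrite gt_eqF.
    apply: continuousD; first exact: cvg_cst.
    exact: is_derive_continuous (is_derive1_powR b t0).
  apply: continuousM; first exact: continuousM.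
  apply: continuousM; first exact: cvg_cst.
  exact: is_derive_continuous (is_derive1_powR (b - 1) t0).
have f0 t : 0 < t -> 0 <= f t.
  by move=> _; rewrite /f !mulr_ge0 ?invr_ge0 ?powR_ge0 ?ltW.
have F1 t : 0 < t -> `|F t| <= 1.
  move=> _; rewrite normrN ger0_norm ?invr_ge0 ?(ltW (p0 t))//.
  by rewrite invf_le1// lerDl powR_ge0.
have intf := integrable_Rpos_bounded_primitive cf f0 dF F1.
(* As [f t = b t^a / (1 + t^b)^2], the claim is [exp (- t) (1 + t^b)^2 <= 2 + 2 C]. It follows from
   [(1 + y)^2 <= 2 + 2 y^2], since [C] bounds [t^(2 b) exp (- t)]. *)
apply: (@integrable_Rpos_le _ f ((2 + 2 * C) / b)) => //.
  by apply: measurable_fun_Rpos => t; exact: continuous_powR_expRN.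
move=> t t0; rewrite ger0_norm ?mulr_ge0 ?powR_ge0 ?expR_ge0//.
rewrite /f (_ : b - 1 = a); last by rewrite /b addrK.
rewrite (_ : _ / b * _ = t `^ a * ((2 + 2 * C) / (1 + t `^ b) ^+ 2)); last first.
  by field; rewrite !gt_eqF.
rewrite ler_wpM2l ?powR_ge0// ler_pdivlMr ?exprn_gt0//.
apply: (@le_trans _ _ (expR (- t) * (2 + 2 * t `^ (2 * b)))).
  rewrite ler_wpM2l ?expR_ge0//.
  rewrite [2 * b]mulrC powRrM powR_mulrn ?powR_ge0//.
  by have := sqr_ge0 (1 - t `^ b); lra.
rewrite mulrDr lerD//.
  by rewrite ler_piMl// expR_le1 oppr_le0 ltW.
by rewrite mulrCA ler_wpM2l// mulrC hC.
Qed.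

Lemma powRE a t : 0 < t -> t `^ a = expR (a * ln t).
Proof. by move=> t0; rewrite /powR gt_eqF. Qed.

Lemma GammaE x :
  Gamma x = \int[mu]_(t in Rpos) (expR (- t) * expR ((x - 1) * ln t)).
Proof.
apply: eq_Rintegral => t; rewrite inE/= in_itv/= andbT => t0.
by rewrite powRE// mulrC.
Qed.

Lemma integrable_Gamma a : -1 < a ->
  mu.-integrable Rpos (fun t => (expR (- t) * expR (a * ln t))%:E).
Proof.
move=> a1; have := integrable_powR_expRN a1; apply: eq_integrable => // t.
by rewrite inE/= in_itv/= andbT => t0; rewrite powRE// mulrC.
Qed.

Lemma measurable_ln_Rpos : measurable_fun Rpos (@ln R).
Proof. by apply: measurable_fun_Rpos => t; exact: continuous_ln. Qed.

Lemma derivable_Gamma x : 0 < x -> derivable (@Gamma R) x 1.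
Proof.
(* Radius [x / 2] keeps both endpoint exponents [x - 1 - x / 2] and [x - 1 + x / 2] above [- 1]. *)
move=> x0; have x20 : 0 < x / 2 by rewrite divr_gt0.
have dG : is_derive (x - 1) 1 _ _ := @is_derive_exp_family _ _ _ mu Rpos
  (fun t => expR (- t)) (@ln R) (measurable_itv _) _ measurable_ln_Rpos
  (x - 1) (x / 2) x20 _ _.
have -> : @Gamma R = (fun a => \int[mu]_(t in Rpos) (expR (- t) * expR (a * ln t)))
    \o (fun x => x - 1) by apply/funext => y; rewrite GammaE.
apply/derivable1_diffP/differentiable_comp => //.
apply/derivable1_diffP; have [] := dG => //.
- by apply/measurable_funTS; apply: measurableT_comp.
- by apply: integrable_Gamma; lra.
- by apply: integrable_Gamma; lra.
Qed.

Lemma Gamma_gt0 x : 0 < x -> 0 < Gamma x.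
Proof.
move=> x0; have intG := @integrable_Gamma (x - 1) ltac:(lra).
pose h t := expR (- t) * expR ((x - 1) * ln t).
have h0 t : 0 <= h t by rewrite mulr_ge0 ?expR_ge0.
have mh : measurable_fun Rpos (EFin \o h) := measurable_int _ intG.
(* A lower bound of the integrand on [[1, 2]], an interval of length one on which
   [0 <= ln t <= 2]. *)
pose c := expR (- 2) * expR (- `|x - 1| * 2).
have c0 : 0 < c by rewrite mulr_gt0 ?expR_gt0.
apply: (lt_le_trans c0); rewrite GammaE -lee_fin /Rintegral fineK; last first.
  exact: integrable_fin_num intG.
apply: (@le_trans _ _ (\int[mu]_(t in `[1%R, 2%R]) (h t)%:E)%E); last first.
  apply: ge0_subset_integral => //.
  - by move=> t _; rewrite lee_fin.
  - move=> t /=; rewrite !in_itv/= andbT => /andP[t1 _].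
    exact: lt_le_trans t1.
rewrite (_ : c%:E = \int[mu]_(t in `[1%R, 2%R]) c%:E)%E; last first.
  rewrite integral_cst//= lebesgue_measure_itv/= lte_fin ltr1n -EFinB.
  by rewrite (_ : 2 - 1 = 1) ?mule1//; ring.
apply: ge0_le_integral => //.
- by move=> t _; rewrite lee_fin ltW.
- apply: measurable_funS mh => // t /=; rewrite !in_itv/= andbT => /andP[t1 _].
  exact: lt_le_trans t1.
move=> t /=; rewrite in_itv/= => /andP[t1 t2]; rewrite lee_fin /c /h.
have t0 : 0 < t by exact: lt_le_trans t1.
apply: ler_pM; rewrite ?expR_ge0// ler_expR ?lerN2//.
have l0 := ln_ge0 t1.
have l2 : ln t <= 2 by apply: le_trans t2; exact/ltW/ln_sublinear.
apply: (@le_trans _ _ (- `|x - 1| * ln t)).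
  by rewrite !mulNr lerN2 ler_wpM2l.
by rewrite ler_wpM2r// lerNl -normrN ler_norm.
Qed.

(** Integration by parts, phrased as the vanishing of the integral of the derivative of
    [t^x exp (- t)]. *)
Lemma GammaS x : 0 < x -> Gamma (x + 1) = x * Gamma x.
Proof.
move=> x0.
have i1 := @integrable_powR_expRN x ltac:(lra).
have i2 := @integrable_powR_expRN (x - 1) ltac:(lra).
pose F t := t `^ x * expR (- t).
pose f t := x * (t `^ (x - 1) * expR (- t)) - t `^ x * expR (- t).
have i2' := integrable_RposZ x i2.
have /eqP : \int[mu]_(t in Rpos) f t = 0.
  have [C1 C10 hC1] := powR_expRN_le (ltW x0).
  have [C2 C20 hC2] := @powR_expRN_le (x + 1) ltac:(lra).
  apply: (@Rintegral_Rpos_eq0 _ f F (1 + C2) x) => //.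
  - move=> t t0; apply: continuousB; last exact: continuous_powR_expRN.
    by apply: continuousM; [exact: cvg_cst|exact: continuous_powR_expRN].
  - move=> t t0; have d := is_derive1_powR x t0.
    by apply: is_derive_eq; rewrite /f /GRing.scale/=; ring.
  - exact: integrable_RposB.
  - move=> t t0; rewrite ger0_norm ?mulr_ge0 ?powR_ge0 ?expR_ge0//.
    rewrite /F mulrC ler_wpM2r ?powR_ge0//; apply: (@le_trans _ _ 1); last by rewrite lerDl.
    by rewrite expR_le1 oppr_le0 ltW.
  - move=> t t0; rewrite ger0_norm ?mulr_ge0 ?powR_ge0 ?expR_ge0//.
    rewrite /F ler_pdivlMr//; apply: (@le_trans _ _ C2); last by rewrite lerDr.
    apply: le_trans (hC2 _ t0); rewrite mulrAC.
    rewrite powRD; last by rewrite (gt_eqF t0) implybT.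
    by rewrite powRr1 ?(ltW t0).
rewrite /f RintegralB// RintegralZl// subr_eq0 => /eqP xG.
rewrite /Gamma xG; apply: eq_Rintegral => t _.
by rewrite addrK.
Qed.

(** The derivative of [y |-> Gamma (y + 1)] at [x] is computed twice: by the chain rule, and through
    [GammaS], which is available near [x] because [x] is positive. *)
Lemma digammaS x : 0 < x -> digamma (x + 1) = digamma x + x^-1.
Proof.
move=> x0; have dG := derivableP (derivable_Gamma x0).
have dGS : is_derive (x + 1) 1 (@Gamma R) ((@Gamma R)^`()%classic (x + 1)).
  by rewrite derive1E; apply/derivableP/derivable_Gamma; lra.
have dl : is_derive x 1 (fun y => Gamma (y + 1)) ((@Gamma R)^`()%classic (x + 1)).
  have dS : is_derive x 1 (fun y : R => y + 1) 1.
    by apply: is_derive_eq; rewrite addr0.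
  have := @is_derive1_comp _ (@Gamma R) (fun y => y + 1) x _ _ dGS dS.
  by rewrite mulr1.
have dr : is_derive x 1 (fun y => Gamma (y + 1)) (Gamma x + x * 'D_1 (@Gamma R) x).
  apply: (@near_eq_is_derive _ _ _ (fun y : R => y * Gamma y)) => //.
  - by near=> y; rewrite GammaS//; near: y; exact: lt_nbhsr.
  - by apply: is_derive_eq; rewrite /GRing.scale/=; ring.
have G0 := Gamma_gt0 x0.
rewrite /digamma -(@derive_val _ _ _ _ _ _ _ dl) (@derive_val _ _ _ _ _ _ _ dr).
by rewrite GammaS// derive1E; field; rewrite !gt_eqF.
Unshelve. all: by end_near. Qed.

Lemma digamma_half_nat k :
  digamma (2^-1 + k%:R) = digamma 2^-1 + odd_harmonic R k.
Proof.
elim: k => [|k ih]; first by rewrite /odd_harmonic big_ord0 !addr0.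
rewrite -[k.+1%:R]natr1 addrA digammaS ?half_nat_gt0// ih.
by rewrite /odd_harmonic big_ord_recr addrA.
Qed.

End gamma_function.

(** * Logarithmic Gaussian moments *)

Section reflection.
Local Open Scope ring_scope.
Variable R : realType.
Implicit Types (f : R -> R).
Local Notation mu := (@lebesgue_measure R).
Local Notation Rpos := (`]0%R, +oo[%classic : set R).

Lemma ge0_integral_reflect f : measurable_fun setT f -> (forall x, 0 <= f x) ->
  (\int[mu]_x (f x)%:E = \int[mu]_(x in Rpos) (f x + f (- x))%:E)%E.
Proof.
move=> mf f0.
have mfN : measurable_fun setT (f \o -%R) by exact: measurableT_comp.
have mE (D : set R) : measurable_fun D (EFin \o f).
  by apply/measurable_EFinP/measurable_funTS.
have mEN (D : set R) : measurable_fun D (EFin \o (f \o -%R)).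
  by apply/measurable_EFinP/measurable_funTS.
under [RHS]eq_integral do rewrite EFinD.
rewrite ge0_integralD//; last 4 first.
- by move=> x _; rewrite lee_fin.
- exact: mE.
- by move=> x _; rewrite lee_fin.
- exact: mEN.
rewrite -(set_itvNyy R) (_ : `]-oo, +oo[%classic = `]-oo, 0%R] `|` Rpos); last first.
  by apply/seteqP; split => x /=; rewrite !in_itv/= andbT// => _; case: (lerP x 0); [left|right].
rewrite ge0_integral_setU//=.
- rewrite addeC; congr (_ + _)%E.
  rewrite [RHS]integral_itv_obnd_cbnd; last exact: mEN.
  rewrite (ge0_integration_by_substitution0 (f := EFin \o (f \o -%R))); last 2 first.
  + exact: mEN.
  + by move=> r; rewrite lee_fin f0.
  by apply: eq_integral => x _ /=; rewrite opprK.
- exact: mE.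
- by move=> x _; rewrite lee_fin.
- apply/disj_setPRL => x /=; rewrite !in_itv/= andbT => x0.
  by apply/negP; rewrite -ltNge.
Qed.

(** The positive part of [f x + f (- x)] is not the sum of the positive parts, so the nonnegative
    case is applied to each part of [f] and the results are subtracted; this is where integrability
    enters. *)
Lemma integral_reflect f : measurable_fun setT f ->
  mu.-integrable Rpos (EFin \o f) -> mu.-integrable Rpos (fun x => (f (- x))%:E) ->
  (\int[mu]_x (f x)%:E = (\int[mu]_(x in Rpos) (f x + f (- x)))%:E)%E.
Proof.
move=> mf i1 i2.
pose fp x := Num.max (f x) 0; pose fn x := Num.max (- f x) 0.
have mfp : measurable_fun setT fp by exact: measurable_maxr.
have mfn : measurable_fun setT fn.
  by apply: measurable_maxr => //; exact: measurableT_comp.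
have fp0 x : 0 <= fp x by rewrite le_max lexx orbT.
have fn0 x : 0 <= fn x by rewrite le_max lexx orbT.
have fE x : fp x - fn x = f x.
  by rewrite /fp /fn; case: (lerP 0 (f x)) => ?; case: (lerP 0 (- f x)) => ?; lra.
have fpn (x : R) : fp x <= `|f x|.
  by rewrite /fp ge_max ler_norm normr_ge0.
have fnn (x : R) : fn x <= `|f x|.
  by rewrite /fn ge_max -normrN ler_norm normr_ge0.
have idom : mu.-integrable Rpos (fun x => (`|f x| + `|f (- x)|)%:E).
  apply: integrable_RposD; first exact: (integrable_norm i1).
  exact: (integrable_norm i2).
have ip : mu.-integrable Rpos (fun x => (fp x + fp (- x))%:E).
  apply: (@integrable_Rpos_le _ _ (fun x => `|f x| + `|f (- x)|) 1) => //.
    by apply/measurable_funTS/measurable_funD => //; exact: measurableT_comp.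
  by move=> t _; rewrite mul1r ger0_norm ?addr_ge0// lerD.
have in_ : mu.-integrable Rpos (fun x => (fn x + fn (- x))%:E).
  apply: (@integrable_Rpos_le _ _ (fun x => `|f x| + `|f (- x)|) 1) => //.
    by apply/measurable_funTS/measurable_funD => //; exact: measurableT_comp.
  by move=> t _; rewrite mul1r ger0_norm ?addr_ge0// lerD.
transitivity (\int[mu]_x (fp x)%:E - \int[mu]_x (fn x)%:E)%E.
  rewrite integralE; congr (_ - _)%E; apply: eq_integral => x _.
    by rewrite funeposE EFin_max.
  by rewrite funenegE EFin_max.
rewrite !ge0_integral_reflect// -integralB_EFin// /Rintegral fineK; last first.
  by apply: integrable_fin_num => //; exact: (integrable_RposD i1 i2).
apply: eq_integral => x _; rewrite -EFinB; congr EFin.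
by rewrite -(fE x) -(fE (- x)); ring.
Qed.

End reflection.

(** * Half-line moments and the mean of the logarithm *)

Section log_gaussian.
Local Open Scope ring_scope.
Variable R : realType.
Implicit Types (m x : R).
Local Notation mu := (@lebesgue_measure R).
Local Notation Rpos := (`]0%R, +oo[%classic : set R).

(** [ln y < y] is applied to [x] and to [x^(- 1 / 2)]; the exponent [- 1 / 2] is integrable at
    [0]. *)
Lemma normr_ln_le x : 0 < x -> `|ln x| <= 2 * (x `^ (- 2^-1) + x).
Proof.
move=> x0; have p0 := powR_gt0 (- 2^-1) x0.
have h1 := ln_sublinear x0.
have h2 := ln_sublinear p0; rewrite ln_powR in h2.
by rewrite ler_norml; apply/andP; split; lra.
Qed.

Lemma expR_gauss_le m x : expR (- (x ^+ 2 / 2)) * expR (m * x) <=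
  expR ((m + 1) ^+ 2 / 2) * expR (- x).
Proof.
rewrite -!expRD ler_expR.
by have := sqr_ge0 (x - (m + 1)); rewrite sqrrB; lra.
Qed.

Definition log_gauss n x : R := x ^+ n * ln x * expR (- (x ^+ 2 / 2)).
Definition log_moment n m : R :=
  \int[mu]_(x in Rpos) (log_gauss n x * expR (m * x)).
Definition half_mass m : R :=
  \int[mu]_(x in Rpos) (expR (- (x ^+ 2 / 2)) * expR (m * x)).

Lemma continuous_gauss x : {for x, continuous (fun x : R => expR (- (x ^+ 2 / 2)))}.
Proof. exact: is_derive_continuous. Qed.

Lemma continuous_log_gauss n x : 0 < x -> {for x, continuous (log_gauss n)}.
Proof.
move=> x0; apply: continuousM; last exact: continuous_gauss.
by apply: continuousM; [exact: exprn_continuous|exact: continuous_ln].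
Qed.

Lemma log_gaussS n x : log_gauss n x * x = log_gauss n.+1 x.
Proof. by rewrite /log_gauss (exprSr _ n); ring. Qed.

Lemma measurable_log_gauss n : measurable_fun Rpos (log_gauss n).
Proof. by apply: measurable_fun_Rpos => x; exact: continuous_log_gauss. Qed.

Lemma log_gauss_le n m x : 0 < x -> `|log_gauss n x * expR (m * x)| <=
  (2 * expR ((m + 1) ^+ 2 / 2)) *
  (x `^ (n%:R - 2^-1) * expR (- x) + x `^ (n%:R + 1) * expR (- x)).
Proof.
move=> x0; have x0' := ltW x0.
rewrite /log_gauss -mulrA normrM [leLHS]mulrC.
rewrite [`|expR _ * _|]ger0_norm ?mulr_ge0 ?expR_ge0//.
apply: (@le_trans _ _ (expR ((m + 1) ^+ 2 / 2) * expR (- x) *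
   (x `^ n%:R * (2 * (x `^ (- 2^-1) + x))))).
  apply: ler_pM; rewrite ?mulr_ge0 ?expR_ge0 ?expR_gauss_le//.
  rewrite normrM normrX gtr0_norm// -powR_mulrn// ler_wpM2l ?powR_ge0//.
  exact: normr_ln_le.
have c (a : R) : (n%:R + a == 0) ==> (x != 0) by rewrite (gt_eqF x0) implybT.
rewrite !powRD ?c// powRr1// le_eqVlt; apply/orP; left; apply/eqP; ring.
Qed.

Let integrable_dom n : mu.-integrable Rpos (EFin \o (fun x =>
  x `^ (n%:R - 2^-1) * expR (- x) + x `^ (n%:R + 1) * expR (- x))).
Proof.
have h := ler0n R n.
have h1 : - 1 < n%:R - 2^-1 :> R by lra.
have h2 : - 1 < n%:R + 1 :> R by lra.
exact: integrable_RposD (integrable_powR_expRN h1) (integrable_powR_expRN h2).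
Qed.

Let measurable_expM m (D : set R) : measurable_fun D (fun x => expR (m * x)).
Proof. by apply/measurable_funTS/measurableT_comp => //; exact: measurable_funM. Qed.

Lemma integrable_log_gauss n m :
  mu.-integrable Rpos (fun x => (log_gauss n x * expR (m * x))%:E).
Proof.
apply: integrable_Rpos_le (integrable_dom n) _ => [|x x0].
  by apply: measurable_funM => //; exact: measurable_log_gauss.
exact: log_gauss_le.
Qed.

Let measurable_gauss (D : set R) : measurable_fun D (fun x => expR (- (x ^+ 2 / 2))).
Proof.
apply: measurable_funTS; apply: continuous_measurable_fun => x.
exact: continuous_gauss.
Qed.

Lemma integrable_gauss_half m :
  mu.-integrable Rpos (fun x => (expR (- (x ^+ 2 / 2)) * expR (m * x))%:E).
Proof.
apply: (@integrable_Rpos_le _ _ (fun x => x `^ 0 * expR (- x))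
   (expR ((m + 1) ^+ 2 / 2))) => [| |x x0].
- exact: measurable_funM.
- by apply: integrable_powR_expRN; lra.
- rewrite powRr0 mul1r ger0_norm ?mulr_ge0 ?expR_ge0//.
  exact: expR_gauss_le.
Qed.

Lemma is_derive_log_moment n m :
  is_derive m 1 (log_moment n) (log_moment n.+1 m).
Proof.
rewrite [X in is_derive _ _ _ X](_ : _ =
    \int[mu]_(x in Rpos) (log_gauss n x * x * expR (m * x))); last first.
  by apply: eq_Rintegral => x _; rewrite log_gaussS.
apply: (@is_derive_exp_family _ _ _ mu Rpos (log_gauss n) id _ _ _ _ 1) => //.
- exact: measurable_log_gauss.
- exact: integrable_log_gauss.
- exact: integrable_log_gauss.
Qed.

(** The integral of the derivative of [x ln x exp (- x^2 / 2 + m x)] vanishes. *)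
Lemma log_moment_recurrence m :
  log_moment 2 m = m * log_moment 1 m + log_moment 0 m + half_mass m.
Proof.
pose e x := expR (m * x).
pose f x := m * (log_gauss 1 x * e x) + log_gauss 0 x * e x +
  expR (- (x ^+ 2 / 2)) * e x - log_gauss 2 x * e x.
pose F x := log_gauss 1 x * e x.
have i0 := integrable_log_gauss 0 m; have i1 := integrable_log_gauss 1 m.
have i2 := integrable_log_gauss 2 m; have ip := integrable_gauss_half m.
have i1' := integrable_RposZ m i1.
have i3 := integrable_RposD i1' i0.
have i4 := integrable_RposD i3 ip.
have : \int[mu]_(x in Rpos) f x = 0.
  (* Factoring [x^(1 / 2)] out of the bound [FK] leaves at most [1 + A1], and multiplying it by [x]
     leaves at most [A1 + A2]. The constant [K * (1 + A1 + A2)] serves both ends. *)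
  have [A1 A10 hA1] := @powR_expRN_le R (3 / 2) ltac:(lra).
  have [A2 A20 hA2] := @powR_expRN_le R 3 ltac:(lra).
  pose K := 2 * expR ((m + 1) ^+ 2 / 2).
  have K0 : 0 <= K by rewrite mulr_ge0 ?expR_ge0.
  have FK x : 0 < x -> `|F x| <= K * (x `^ 2^-1 * expR (- x) + x `^ 2 * expR (- x)).
    move=> x0; have := @log_gauss_le 1 m x x0.
    have -> : 1%:R - 2^-1 = 2^-1 :> R by lra.
    by have -> : 1%:R + 1 = 2 :> R by lra.
  have pD (x a b : R) : 0 < x -> x `^ (a + b) = x `^ a * x `^ b.
    by move=> x0; rewrite powRD// (gt_eqF x0) implybT.
  apply: (@Rintegral_Rpos_eq0 _ f F (K * (1 + A1 + A2)) 2^-1) => //.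
  - move=> x x0.
    have ce : {for x, continuous e} by exact: is_derive_continuous.
    have cl n : {for x, continuous (fun x => log_gauss n x * e x)}.
      by apply: continuousM => //; exact: continuous_log_gauss.
    apply: continuousB => //; apply: continuousD; last first.
      by apply: continuousM => //; exact: continuous_gauss.
    by apply: continuousD => //; apply: continuousM => //; exact: cvg_cst.
  - move=> x x0; have d := is_derive1_ln x0; rewrite /F /log_gauss /e.
    apply: is_derive_eq; rewrite /f /log_gauss /e /GRing.scale/=.
    by field; rewrite gt_eqF.
  - exact: (integrable_RposB i4 i2).
  - move=> x x0; apply: (le_trans (FK x x0)); rewrite -mulrA ler_wpM2l//.
    rewrite (_ : x `^ 2 = x `^ 2^-1 * x `^ (3 / 2)); last first.
      by rewrite -pD//; congr (_ `^ _); lra.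
    rewrite -mulrA -mulrDr mulrC ler_wpM2r ?powR_ge0//.
    apply: (@le_trans _ _ (1 + A1)); last by rewrite lerDl.
    by rewrite lerD ?hA1// expR_le1 oppr_le0 ltW.
  - move=> x x0; apply: (le_trans (FK x x0)); rewrite -mulrA ler_wpM2l//.
    rewrite ler_pdivlMr// mulrDl.
    rewrite !(mulrAC _ (expR _)) -[X in _ `^ _ * X]powRr1 ?(ltW x0)//.
    rewrite -[X in _ + _ * X * _ <= _](@powRr1 _ x) ?(ltW x0)// -!pD//.
    have -> : 2^-1 + 1 = 3 / 2 :> R by lra.
    have -> : 2 + 1 = 3 :> R by lra.
    by have := hA1 x x0; have := hA2 x x0; lra.
rewrite /f RintegralB//.
rewrite RintegralD// RintegralD// RintegralZl//.
rewrite -!/(log_moment _ m) -/(half_mass m).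
by move=> h; lra.
Qed.

(** Only values of [h] on the open half-line enter the right-hand side, so junk
    values such as [ln 0 = 0] are harmless. *)
Lemma integral_even_gauss (h : R -> R) m : measurable_fun setT h ->
  (forall x, h (- x) = h x) ->
  (forall m, mu.-integrable Rpos
     (fun x => (h x * expR (- (x ^+ 2 / 2)) * expR (m * x))%:E)) ->
  (\int[mu]_x (h x * expR (- ((x - m) ^+ 2 / 2)))%:E =
   (expR (- (m ^+ 2 / 2)) *
     (\int[mu]_(x in Rpos) (h x * expR (- (x ^+ 2 / 2)) * expR (m * x)) +
      \int[mu]_(x in Rpos) (h x * expR (- (x ^+ 2 / 2)) * expR (- m * x))))%:E)%E.
Proof.
move=> mh hN ih.
pose k := expR (- (m ^+ 2 / 2)).
have E (x : R) : h x * expR (- ((x - m) ^+ 2 / 2)) =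
    k * (h x * expR (- (x ^+ 2 / 2)) * expR (m * x)).
  by rewrite /k mulrCA -!mulrA -!expRD; congr (_ * expR _); field.
have EN (x : R) : h (- x) * expR (- ((- x - m) ^+ 2 / 2)) =
    k * (h x * expR (- (x ^+ 2 / 2)) * expR (- m * x)).
  by rewrite hN /k mulrCA -!mulrA -!expRD; congr (_ * expR _); field.
have i1 := integrable_RposZ k (ih m).
have i2 := integrable_RposZ k (ih (- m)).
rewrite (@integral_reflect _ (fun x => h x * expR (- ((x - m) ^+ 2 / 2)))).
- congr EFin; rewrite -/k mulrDr -!RintegralZl//; [|exact: ih..].
  rewrite -RintegralD//.
  by apply: eq_Rintegral => x _; rewrite E EN.
- apply: measurable_funM => //; apply: continuous_measurable_fun => x.
  exact: is_derive_continuous.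
- by apply: eq_integrable i1 => // x _; rewrite /= E.
- by apply: eq_integrable i2 => // x _; rewrite /= EN.
Qed.

(** The integral of [ln |y| exp (- (y - m)^2 / 2)] folded onto the half-line; [normal_peak 1]
    normalises it to the [L m] of the overview. *)
Definition log_mean m : R :=
  expR (- (m ^+ 2 / 2)) * (log_moment 0 m + log_moment 0 (- m)).

(** The total mass [1] of the normal density of mean [m] and variance [1], folded by
    [integral_even_gauss] with the constant function. *)
Lemma half_massD m :
  half_mass m + half_mass (- m) = (normal_peak 1)^-1 * expR (m ^+ 2 / 2).
Proof.
have p0 : 0 < normal_peak (1 : R) by rewrite normal_peak_gt0// oner_neq0.
have := integral_normal_pdf m (1 : R).
rewrite (normal_pdfE _ (oner_neq0 R)).
have E x : normal_fun m 1 x = cst 1 x * expR (- ((x - m) ^+ 2 / 2)).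
  by rewrite mul1r /normal_fun; congr expR; rewrite expr1n; field.
under eq_integral do rewrite EFinM E.
rewrite ge0_integralZl//; last 3 first.
- apply/measurable_EFinP; apply: continuous_measurable_fun => x.
  by rewrite /cst; exact: is_derive_continuous.
- by move=> x _; rewrite lee_fin mulr_ge0 ?expR_ge0.
- by rewrite lee_fin ltW.
have i1 k : mu.-integrable Rpos
    (fun x => (cst 1 x * expR (- (x ^+ 2 / 2)) * expR (k * x))%:E).
  by apply: eq_integrable (integrable_gauss_half k) => // x _; rewrite /= mul1r.
rewrite integral_even_gauss//.
have h k : \int[mu]_(x in Rpos) (cst 1 x * expR (- (x ^+ 2 / 2)) * expR (k * x)) =
    half_mass k by apply: eq_Rintegral => x _; rewrite mul1r.
rewrite !h -EFinM => -[] e; rewrite expRN in e.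
have ne := expR_gt0 (m ^+ 2 / 2).
have S : half_mass m + half_mass (- m) = (normal_peak 1)^-1 * expR (m ^+ 2 / 2) *
    (normal_peak 1 * ((expR (m ^+ 2 / 2))^-1 * (half_mass m + half_mass (- m)))).
  by field; rewrite !gt_eqF.
by rewrite {1}S e mulr1.
Qed.

Lemma log_mean_kl_sum m : normal_peak 1 * log_mean m =
  normal_peak 1 * log_mean 0 + 2^-1 * kl_sum (m ^+ 2 / 2).
Proof.
have p0 : 0 < normal_peak (1 : R) by rewrite normal_peak_gt0// oner_neq0.
pose c : R := (normal_peak 1)^-1.
(* This is [h' - m h]. In its derivative the recurrence at [x] and [- x] cancels every logarithmic
   moment and leaves the two half masses. *)
pose E m := log_moment 1 m - log_moment 1 (- m) -
  m * (log_moment 0 m + log_moment 0 (- m)).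
have dN n x : is_derive x 1 (fun x => log_moment n (- x)) (- log_moment n.+1 (- x)).
  have := @is_derive1_comp _ (log_moment n) -%R x _ _
    (is_derive_log_moment n (- x)) (is_deriveNid x 1).
  by rewrite mulrN1.
have EW x : E x = c * (x * psum (erfi_coef R) (x ^+ 2 / 2)).
  move: x; apply: (@eq_of_is_derive _ E
    (fun x => c * (x * psum (erfi_coef R) (x ^+ 2 / 2)))
    (fun x => c * expR (x ^+ 2 / 2))).
  - by rewrite /E oppr0 subrr !mul0r subr0 mulr0.
  - move=> x; have d1 := dN 1%N x; have d0 := dN 0%N x.
    have e1 := is_derive_log_moment 1 x; have e0 := is_derive_log_moment 0 x.
    rewrite /E; apply: is_derive_eq; rewrite /c -half_massD /GRing.scale/=.
    have r1 := log_moment_recurrence x; have r2 := log_moment_recurrence (- x).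
    by rewrite r1 r2; ring.
  - by move=> x; have d := is_derive_erfi x; apply: is_derive_eq;
      rewrite /GRing.scale/=; ring.
have h0 : (0 : R) ^+ 2 / 2 = 0 by rewrite expr0n mul0r.
move: m; apply: (@eq_of_is_derive _ (fun m => normal_peak 1 * log_mean m)
  (fun m => normal_peak 1 * log_mean 0 + 2^-1 * kl_sum (m ^+ 2 / 2))
  (fun x => expR (- (x ^+ 2 / 2)) * (x * psum (erfi_coef R) (x ^+ 2 / 2)))).
- rewrite h0 /kl_sum (psum0 (exp_bounded_harmonic R)).
  by rewrite /harmonic_coef /odd_harmonic big_ord0 mul0r !mulr0 addr0.
- move=> x; have d0 := dN 0%N x; have e0 := is_derive_log_moment 0 x.
  have de := is_derive_comp_half_sqr (F := fun x => expR (- x)) (m := x).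
  have dex : is_derive x 1 (fun x : R => expR (- (x ^+ 2 / 2)))
      (- expR (- (x ^+ 2 / 2)) * x).
    by apply: de; apply: is_derive_eq; rewrite mulrN1.
  rewrite /log_mean; apply: is_derive_eq; rewrite /GRing.scale/=.
  have := EW x; rewrite /E /c => e.
  have -> : x * psum (erfi_coef R) (x ^+ 2 / 2) = normal_peak 1 * E x.
    by rewrite EW /c mulVKf// gt_eqF.
  by rewrite /E; ring.
- move=> x; have d := is_derive_comp_half_sqr (is_derive_kl_sum (x ^+ 2 / 2)).
  by apply: is_derive_eq; rewrite /kl_slope /GRing.scale/=; field.
Qed.

End log_gaussian.

(** * Dawson's integral and Kummer's function *)

Section dawson_integral.
Local Open Scope ring_scope.
Variable R : realType.
Implicit Types (u x : R).

Lemma is_derive_erfi_sqr x :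
  is_derive x 1 (fun x => x * psum (erfi_coef R) (x ^+ 2)) (expR (x ^+ 2)).
Proof.
have d2 : is_derive x 1 (fun x : R => x ^+ 2) (2 * x).
  by apply: is_derive_eq; rewrite /GRing.scale/=; ring.
have dW := @is_derive1_comp _ _ (fun x => x ^+ 2) x _ _
  (exp_bounded_is_derive (x ^+ 2) (exp_bounded_erfi R)) d2.
apply: is_derive_eq; rewrite -/(psum _ _) -psum_erfi_diffs /GRing.scale/=.
by rewrite /psum; ring.
Qed.

Lemma dawsonE x : 0 < x -> dawson x = expR (- x ^+ 2) * (x * psum (erfi_coef R) (x ^+ 2)).
Proof.
move=> x0; rewrite /dawson; congr (_ * _).
rewrite [X in _ - X](_ : _ = 0); last first.
  by rewrite set_itv_ge ?Rintegral_set0// bnd_simp -ltNge.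
pose F t := t * psum (erfi_coef R) (t ^+ 2).
have cF (t : R) : {for t, continuous F}.
  exact: is_derive_continuous (is_derive_erfi_sqr t).
rewrite subr0 /Rintegral (@continuous_FTC2 _ (fun t => expR (t ^+ 2)) F)//.
- by rewrite /F mul0r -EFinB subr0.
- by apply: continuous_subspaceT => t; exact: is_derive_continuous.
- split; [|exact/cvg_at_right_filter/cF|exact/cvg_at_left_filter/cF].
  by move=> t _; have [] := is_derive_erfi_sqr t.
- by move=> t _; rewrite derive1E; have [_ ->] := is_derive_erfi_sqr t.
Qed.

(** The factor [x] in [dawsonE] cancels the square root, and the value [1] at [0] is the constant
    coefficient of the series. Continuity at [0] is thereby inherited from an entire function. *)
Lemma KL_slopeE u : 0 <= u -> KL_slope u = kl_slope u.
Proof.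
rewrite le_eqVlt => /predU1P[<-|u0].
  rewrite /KL_slope eqxx /kl_slope oppr0 expR0 mul1r.
  rewrite (psum0 (exp_bounded_erfi R)) /erfi_coef.
  by rewrite mul0r add0r mul1r fact0 invr1.
have s0 : 0 < Num.sqrt u by rewrite sqrtr_gt0.
rewrite /KL_slope gt_eqF// dawsonE// sqr_sqrtr ?(ltW u0)// /kl_slope.
by field; rewrite gt_eqF.
Qed.

Lemma continuous_kl_slope : continuous (@kl_slope R).
Proof.
move=> u; have d := exp_bounded_is_derive u (exp_bounded_erfi R).
rewrite -/(psum _) in d.
by rewrite /kl_slope; exact: is_derive_continuous.
Qed.

End dawson_integral.

(** * Derivative of Kummer's function in its first parameter *)

Section kummer_parameter_derivative.
Local Open Scope ring_scope.
Variable R : realType.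
Implicit Types (a z : R).

(** The product is a polynomial in [a] with nonnegative coefficients, so its increment from [0] is
    at most [|a|] times the increment from [0] to [1], where it equals [(k + 1)!]. *)
Lemma prod_addS_fact_le k a : `|a| <= 1 ->
  `|\prod_(i < k) (a + i.+1%:R) - k`!%:R| <= `|a| * (k.+1`!%:R - k`!%:R).
Proof.
move=> a1; elim: k => [|k ih].
  by rewrite big_ord0 !fact0 factS fact0 muln1 !subrr normr0 mulr0.
rewrite big_ord_recr/=.
set p := \prod_(i < k) _ in ih *.
have e : p * (a + k.+1%:R) - k.+1`!%:R =
    (p - k`!%:R) * (a + k.+1%:R) + a * k`!%:R.
  by rewrite factS natrM; ring.
rewrite e (le_trans (ler_normD _ _))// !normrM [`|k`!%:R|]ger0_norm//.
have ak : `|a + k.+1%:R| <= k.+2%:R.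
  apply: (le_trans (ler_normD _ _)); rewrite [`|k.+1%:R|]ger0_norm//.
  by rewrite -[leRHS]nat1r lerD2r.
have h : `|p - k`!%:R| * `|a + k.+1%:R| <=
    `|a| * (k.+1`!%:R - k`!%:R) * k.+2%:R by rewrite ler_pM.
apply: (le_trans (lerD h (lexx _))).
rewrite le_eqVlt; apply/orP; left; apply/eqP.
by rewrite !factS !natrM -[k.+2%:R]natr1 -[k.+1%:R]natr1; ring.
Qed.

(* By [qE], a coefficient of [M(a; 1/2; z)] is its value at [a = 0], plus [a]
   times the coefficient of the derivative, plus an error [a * e a k = O(a^2)]. *)
Let q a k : R := rising_factorial a k / rising_factorial 2^-1 k / k`!%:R.
Let K k : R := (-1) ^+ k * kummer_coef R k.
Let e a k : R := if k is j.+1 then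
  (\prod_(i < j) (a + i.+1%:R) - j`!%:R) / (rising_factorial 2^-1 k * k`!%:R) else 0.
(** A majorant of [e a k / a] uniform in [|a| <= 1]: the product estimate gives [k * (k - 1)!] above
    the denominator, and [(k - 1)!] is at most twice the rising factorial. *)
Let d k : R := k%:R * (2 * (k`!%:R)^-1).

Let rising_factorialS_l a k :
  rising_factorial a k.+1 = a * \prod_(i < k) (a + i.+1%:R).
Proof. by rewrite /rising_factorial big_ord_recl addr0. Qed.

Let qE a k : q a k = (k == 0)%:R + a * (K k + e a k).
Proof.
case: k => [|k].
  rewrite /q /K /e /rising_factorial !big_ord0 fact0 mulr0 addr0 mulr0 addr0.
  by rewrite !divr1.
rewrite /q rising_factorialS_l /K /e add0r.
have h := rising_factorial_half_gt0 R k.+1.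
rewrite /kummer_coef !mulrA -exprMn mulrNN mulr1 expr1n mul1r.
by field; rewrite fact_neq0 gt_eqF.
Qed.

Let bd : exp_bounded d.
Proof.
apply: exp_bounded_natmul; exists 2, 1; split=> // k.
by rewrite expr1n mulr1 ger0_norm ?mulr_ge0.
Qed.

Let e_le a k : `|a| <= 1 -> `|e a k| <= `|a| * d k.
Proof.
move=> a1; case: k => [|k]; first by rewrite /e normr0 mulr_ge0// /d mul0r.
have h := rising_factorial_half_gt0 R k.+1.
rewrite /e normrM normfV [X in _ / X]ger0_norm ?mulr_ge0 ?(ltW h)//.
rewrite ler_pdivrMr ?mulr_gt0 ?ltr0n ?fact_gt0//.
apply: (le_trans (prod_addS_fact_le k a1)); rewrite -mulrA ler_wpM2l//.
have -> : d k.+1 * (rising_factorial 2^-1 k.+1 * k.+1`!%:R) =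
    k.+1%:R * (2 * rising_factorial 2^-1 k.+1).
  by rewrite /d; field; rewrite fact_neq0.
apply: (@le_trans _ _ (k.+1%:R * k`!%:R)).
  by rewrite factS natrM lerBlDr lerDl.
by rewrite ler_wpM2l// rising_factorial_half_ge.
Qed.

Let be a : `|a| <= 1 -> exp_bounded (e a).
Proof.
move=> a1; have [A [B [A0 B0 h]]] := exp_boundedZ `|a| bd.
exists A, B; split => // k; apply: le_trans (h k).
by apply: (le_trans (e_le k a1)); exact: ler_norm.
Qed.

Let bK : exp_bounded K.
Proof.
have [A [B [A0 B0 h]]] := exp_bounded_kummer R.
exists A, B; split => // k; apply: le_trans (h k).
by rewrite /K normrM normrX normrN1 expr1n mul1r.
Qed.

Let b0 : exp_bounded (fun k => (k == 0)%:R : R).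
Proof.
exists 1, 1; split => // -[|k].
  by rewrite eqxx normr1 expr1n !mul1r fact0 invr1.
by rewrite normr0 divr_ge0// mulr_ge0.
Qed.

Let kummerME a z : `|a| <= 1 -> kummerM a 2^-1 z =
  limn (pseries (fun k => (k == 0)%:R : R) z) + a * (limn (pseries K z) + limn (pseries (e a) z)).
Proof.
move=> a1.
have cK := @exp_bounded_cvg _ _ z bK.
have ce := @exp_bounded_cvg _ _ z (be a1).
have c0 := @exp_bounded_cvg _ _ z b0.
have cKe : cvgn (pseries (fun k => K k + e a k) z).
  by apply/cvg_ex; eexists; exact: cvg_pseriesD.
have caKe : cvgn (pseries (fun k => a * (K k + e a k)) z).
  have -> : pseries (fun k => a * (K k + e a k)) z =
      (fun n => a * pseries (fun k => K k + e a k) z n).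
    apply/funext => n; rewrite /pseries /series /= mulr_sumr.
    by apply: eq_bigr => i _; rewrite mulrA.
  by apply: is_cvgMr.
rewrite -limn_pseriesD// -limn_pseriesZ// -limn_pseriesD//.
rewrite /kummerM; congr (limn _); apply/funext => n; rewrite /pseries /series/=.
by apply: eq_bigr => k _; rewrite -qE /q; ring.
Qed.

Lemma is_derive_kummerM z : is_derive (0 : R) (1 : R) (fun a => kummerM a 2^-1 z)
  (psum (kummer_coef R) (- z)).
Proof.
have -> : psum (kummer_coef R) (- z) = limn (pseries K z).
  rewrite /psum; congr (limn _); apply/funext => n; rewrite /pseries /series/=.
  by apply: eq_bigr => k _; rewrite /K (exprNn z); ring.
set L := limn (pseries K z).
pose M a := kummerM a 2^-1 z.
(* The difference quotient, filled in at [0]. By [kummerME] it differs from [L] by the series of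
   [e a], hence by at most [B * |a|]. *)
pose g a := if a == 0 then L else (M a - M 0) / a.
apply/is_derive1_caratheodory; exists g; split; last by rewrite /g eqxx.
- move=> a; rewrite subr0 /g; case: eqP => [->|/eqP a0]; first by rewrite subrr mulr0.
  by rewrite divfK.
pose B := limn (pseries d `|z|).
have gL a : `|a| <= 1 -> `|g a - L| <= B * `|a|.
  move=> a1.
  have eB : `|limn (pseries (e a) z)| <= B * `|a|.
    have ce := @exp_bounded_cvg _ _ z (be a1).
    have cd := @exp_bounded_cvg _ _ `|z| bd.
    rewrite /B mulrC -limn_pseriesZ//.
    have cad := @exp_bounded_cvg _ _ `|z| (exp_boundedZ `|a| bd).
    have le k : `|e a k * z ^+ k| <= `|a| * d k * `|z| ^+ k.
      by rewrite normrM normrX ler_wpM2r ?exprn_ge0 ?e_le.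
    have cn : cvgn [normed (pseries (e a) z)].
      apply: (series_le_cvg _ _ _ cad) => k //=.
      exact: le_trans (le k).
    apply: (le_trans (lim_series_norm cn)).
    exact: lim_series_le.
  rewrite /g; case: eqP => [->|/eqP a0]; first by rewrite subrr !normr0 mulr0.
  rewrite /M !kummerME ?normr0// mul0r addr0 [X in X / a](_ : _ =
    a * (L + limn (pseries (e a) z))); last by rewrite /L; ring.
  by rewrite mulrAC divff// mul1r addrC addKr.
apply/cvgrPdist_le => eps eps0; rewrite /g eqxx -/L.
have B0 : 0 < `|B| + 1 by rewrite ltr_wpDl.
have n1 : \forall a \near (0 : R), `|a| <= 1 by exact: (@nbhs0_le R R).
have n2 : \forall a \near (0 : R), `|a| <= eps / (`|B| + 1).
  by apply: (@nbhs0_le R R); rewrite divr_gt0.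
near=> a; rewrite distrC -/(g a).
have a1 : `|a| <= 1 by near: a.
apply: (le_trans (gL a a1)).
apply: (@le_trans _ _ ((`|B| + 1) * `|a|)).
  by rewrite ler_wpM2r// (le_trans (ler_norm _))// lerDl.
by rewrite mulrC -ler_pdivlMr//; near: a.
Unshelve. all: by end_near. Qed.

End kummer_parameter_derivative.

(** * The divergence *)

Section kl_normal.
Local Open Scope ring_scope.
Variable R : realType.
Implicit Types (m x s sigma C : R).
Local Notation mu := (@lebesgue_measure R).
Local Notation Rpos := (`]0%R, +oo[%classic : set R).
Local Notation N := (normal_peak (1 : R)).

Let N_gt0 : 0 < N. Proof. by rewrite normal_peak_gt0// oner_neq0. Qed.

Lemma normal_pdf_affine (m0 s x : R) : 0 < s ->
  s * normal_pdf m0 s (s * x) = N * expR (- ((x - m0 / s) ^+ 2 / 2)).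
Proof.
move=> s0; rewrite normal_pdfE ?gt_eqF// mulrA; congr (_ * expR _).
  rewrite /normal_peak expr1n mul1r -mulrnAr sqrtrM ?sqr_ge0//.
  by rewrite sqrtr_sqr gtr0_norm// invfM mulrA divff ?mul1r// gt_eqF.
by rewrite /normal_fun; field; rewrite gt_eqF.
Qed.

(** Only [sigma ^+ 2] is assumed positive, so [sigma] may be negative; the rescaling is done with
    its absolute value. *)
Lemma normal_pdf_normr m0 sigma : normal_pdf m0 `|sigma| = normal_pdf m0 sigma.
Proof.
apply/funext => x; rewrite /normal_pdf normr_eq0; case: ifPn => //.
by rewrite /normal_peak /normal_fun real_normK ?num_real.
Qed.

Definition half_second_moment : R :=
  \int[mu]_(x in Rpos) (x ^+ 2 / 2 * expR (- (x ^+ 2 / 2))).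

Lemma integrable_sqr_gauss k : mu.-integrable Rpos
  (EFin \o (fun x => x ^+ 2 / 2 * (expR (- (x ^+ 2 / 2)) * expR (k * x)))).
Proof.
apply: (@integrable_Rpos_le _ _ (fun x => x `^ 2 * expR (- x))
   (2^-1 * expR ((k + 1) ^+ 2 / 2))) => [| |x x0].
- apply: measurable_fun_Rpos => x _; exact: is_derive_continuous.
- by apply: integrable_powR_expRN; lra.
- have x0' := ltW x0.
  rewrite powR_mulrn// ger0_norm ?mulr_ge0 ?expR_ge0 ?exprn_ge0//.
  have := ler_wpM2l (exprn_ge0 2 x0') (expR_gauss_le k x); lra.
Qed.

Lemma integral_sqr_gauss (b : R) :
  (\int[mu]_x (N * (b - x ^+ 2 / 2) * expR (- ((x - 0) ^+ 2 / 2)))%:E =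
   (b - 2 * N * half_second_moment)%:E)%E.
Proof.
have E k x : N * (b - x ^+ 2 / 2) * expR (- (x ^+ 2 / 2)) * expR (k * x) =
    N * b * (expR (- (x ^+ 2 / 2)) * expR (k * x)) -
    N * (x ^+ 2 / 2 * (expR (- (x ^+ 2 / 2)) * expR (k * x))) by ring.
have i1 k := integrable_RposZ (N * b) (integrable_gauss_half k).
have i2 k := integrable_RposZ N (integrable_sqr_gauss k).
rewrite (@integral_even_gauss _ (fun x => N * (b - x ^+ 2 / 2))).
- congr EFin; rewrite oppr0 expr0n mul0r oppr0 expR0 mul1r.
  under eq_Rintegral do rewrite E.
  have j1 := @integrable_gauss_half R; have j2 := integrable_sqr_gauss.
  rewrite RintegralB// !RintegralZl//; last exact: j1.
  rewrite -/(half_mass 0) (_ : \int[mu]_(x in Rpos) _ = half_second_moment); last first.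
    by apply: eq_Rintegral => x _; rewrite mul0r expR0 mulr1.
  have := half_massD (0 : R); rewrite oppr0 expr0n mul0r expR0 mulr1 => h.
  have -> : half_mass (0 : R) = N^-1 / 2 by lra.
  by field; rewrite gt_eqF.
- by apply: continuous_measurable_fun => x; exact: is_derive_continuous.
- by move=> x; rewrite sqrrN.
- move=> k; apply: eq_integrable (integrable_RposB (i1 k) (i2 k)) => // x _.
  by rewrite /= E.
Qed.

(** The expectation of [ln p] after rescaling by [s]. Its term [- ln s] cancels the one in the
    expectation of [ln q], which leaves a function of the ratio [m] alone. *)
Lemma integral_log_ratio_gauss C s m : 0 < C -> 0 < s ->
  (\int[mu]_x (N * ln (C / `|s * x|) * expR (- ((x - m) ^+ 2 / 2)))%:E =
   (ln C - ln s - N * log_mean m)%:E)%E.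
Proof.
move=> C0 s0; pose b := ln C - ln s.
have E k x : x \in Rpos ->
    N * ln (C / `|s * x|) * expR (- (x ^+ 2 / 2)) * expR (k * x) =
    N * b * (expR (- (x ^+ 2 / 2)) * expR (k * x)) -
    N * (log_gauss 0 x * expR (k * x)).
  rewrite inE/= in_itv/= andbT => x0; have sx0 := mulr_gt0 s0 x0.
  rewrite gtr0_norm// ln_div ?posrE// lnM ?posrE// /log_gauss expr0 /b.
  by ring.
have i1 k := integrable_RposZ (N * b) (integrable_gauss_half k).
have i2 k := integrable_RposZ N (integrable_log_gauss 0 k).
have I k : \int[mu]_(x in Rpos)
      (N * ln (C / `|s * x|) * expR (- (x ^+ 2 / 2)) * expR (k * x)) =
    N * b * half_mass k - N * log_moment 0 k.
  under eq_Rintegral do rewrite E//.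
  have j1 := @integrable_gauss_half R; have j2 := @integrable_log_gauss R 0.
  by rewrite RintegralB// !RintegralZl//; [exact: j2|exact: j1].
rewrite (@integral_even_gauss _ (fun x => N * ln (C / `|s * x|))).
- rewrite !I /log_mean; congr EFin.
  have -> : half_mass (- m) = N^-1 * expR (m ^+ 2 / 2) - half_mass m.
    by rewrite -half_massD; ring.
  rewrite expRN /b; field.
  by rewrite expR_eq0 gt_eqF.
- apply: measurable_funM => //; apply: measurableT_comp => //.
  apply: measurable_funM => //.
  have -> : (fun x : R => `|s * x|^-1) = (fun x => x `^ (-1)) \o (fun x => `|s * x|).
    by apply/funext => x /=; rewrite powR_inv1.
  apply: measurableT_comp; first exact: measurable_powR.
  by apply: measurableT_comp => //; exact: measurable_funM.
- by move=> x; rewrite mulrN normrN.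
- move=> k; apply: eq_integrable (integrable_RposB (i1 k) (i2 k)) => // x xR.
  by rewrite /= E.
Qed.

Lemma KL_normalE C : 0 < C -> exists c : R, forall m0 sigma, 0 < sigma ^+ 2 ->
  KL_normal C m0 sigma =
    (c + 2^-1 * kl_sum (m0 ^+ 2 / (2 * sigma ^+ 2)))%:E.
Proof.
move=> C0; exists (ln N - 2 * N * half_second_moment - ln C + N * log_mean 0).
move=> m0 sigma sigma0.
pose s := `|sigma|.
have s0 : 0 < s.
  by rewrite normr_gt0; apply: contraTneq sigma0 => ->; rewrite expr0n ltxx.
have mpdf : measurable_fun setT (normal_pdf m0 s) := measurable_normal_pdf _ _.
have mlnC : measurable_fun setT (fun w : R => ln (C / `|w|)).
  apply: measurableT_comp => //; apply: measurable_funM => //.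
  have -> : (fun x : R => `|x|^-1) = (fun x => x `^ (-1)) \o (fun x => `|x|).
    by apply/funext => x /=; rewrite powR_inv1.
  apply: measurableT_comp; first exact: measurable_powR.
  exact: measurableT_comp.
have mln : measurable_fun setT (fun w : R => ln (normal_pdf m0 s w)).
  exact: measurableT_comp.
rewrite /KL_normal /KL !unlock.
rewrite !integral_normal_prob -?(normal_pdf_normr m0 sigma) -/s//.
have -> : (\int[mu]_x (normal_pdf m0 s x * ln (normal_pdf m0 s x))%:E =
    (ln N - ln s - 2 * N * half_second_moment)%:E)%E.
  (* Here the variable is centred at [m0], as the entropy is translation invariant. For [ln p] below
     it is only scaled, so that [|w|] stays a multiple of [|x|]. *)
  rewrite -integral_sqr_gauss (integral_affine m0 s0); last exact: measurable_funM.
  apply: eq_integral => x _; congr EFin.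
  have E : normal_pdf m0 s (s * x + m0) = N / s * expR (- (x ^+ 2 / 2)).
    have := normal_pdf_affine m0 (x + m0 / s) s0.
    rewrite addrK mulrDr mulrCA divff ?gt_eqF// mulr1 => h.
    by apply: (mulfI (lt0r_neq0 s0)); rewrite h; field; rewrite gt_eqF.
  rewrite E lnM ?posrE ?expR_gt0 ?divr_gt0// ln_div ?posrE// expRK subr0.
  by field; rewrite gt_eqF.
have -> : (\int[mu]_x (normal_pdf m0 s x * ln (C / `|x|))%:E =
    (ln C - ln s - N * log_mean (m0 / s))%:E)%E.
  rewrite -integral_log_ratio_gauss// (integral_affine 0 s0); last exact: measurable_funM.
  apply: eq_integral => x _; congr EFin.
  rewrite addr0 mulrA normal_pdf_affine//; ring.
rewrite -EFinB log_mean_kl_sum.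
have -> : (m0 / s) ^+ 2 / 2 = m0 ^+ 2 / (2 * sigma ^+ 2).
  rewrite -(real_normK (num_real sigma)) -/s; field; rewrite gt_eqF//.
by congr EFin; ring.
Qed.

Lemma cvg_digamma_series u :
  [series u ^+ k / k`!%:R * digamma (2^-1 + k%:R)]_k @ \oo -->
    expR u * (digamma (2^-1 : R) + kl_sum u).
Proof.
have bexp : exp_bounded (fun k => (k`!%:R)^-1 : R).
  exists 1, 1; split => // k; rewrite expr1n mul1r mul1r ger0_norm//.
have b1 := exp_boundedZ (digamma (2^-1 : R)) bexp.
have -> : [series u ^+ k / k`!%:R * digamma (2^-1 + k%:R)]_k =
    pseries (fun k => digamma (2^-1 : R) * (k`!%:R)^-1 + harmonic_coef R k) u.
  apply/funext => n; rewrite /pseries /series/=; apply: eq_bigr => k _.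
  by rewrite digamma_half_nat /harmonic_coef; ring.
have -> : expR u * (digamma (2^-1 : R) + kl_sum u) =
    limn (pseries (fun k => digamma (2^-1 : R) * (k`!%:R)^-1) u) +
    limn (pseries (harmonic_coef R) u).
  rewrite limn_pseriesZ; last exact: exp_bounded_cvg.
  rewrite -!/(psum _ u) psum_exp /kl_sum expRN; field.
  by rewrite expR_eq0.
by apply: cvg_pseriesD; apply: exp_bounded_cvg => //; exact: exp_bounded_harmonic.
Qed.

End kl_normal.

Theorem proposition2 (R : realType) (C : R) (C_gt0 : 0 < C) :
  (exists c1 c2 : R, forall mu sigma : R, 0 < sigma ^+ 2 ->
    let u := mu ^+ 2 / (2 * sigma ^+ 2) in
    [/\ cvgn [series u ^+ k / k`!%:R * digamma (2^-1 + k%:R)]_k,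
        KL_normal C mu sigma =
          (c1 + 2^-1 * (ln 2 + expR (- u) *
             limn [series u ^+ k / k`!%:R * digamma (2^-1 + k%:R)]_k))%:E,
        derivable (fun a : R => kummerM a 2^-1 (- u)) 0 1 &
        KL_normal C mu sigma =
          (c2 - 2^-1 * (fun a : R => kummerM a 2^-1 (- u))^`()%classic 0)%:E])
  /\
  (exists f : R -> R,
    [/\ forall mu sigma : R, 0 < sigma ^+ 2 ->
          KL_normal C mu sigma = (f (mu ^+ 2 / (2 * sigma ^+ 2)))%:E,
        h^-1 * (f h - f 0) @[h --> 0^'+] --> KL_slope (0 : R),
        forall u : R, 0 < u -> is_derive u 1 f (KL_slope u) &
        {within `[0, +oo[, continuous (@KL_slope R)}]).
Proof.
have [c KLE] := KL_normalE C_gt0.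
(* This extends the divergence to an entire function of [u], so the one-sided derivative at [0]
   comes from a two-sided one. *)
pose f u : R := c + 2^-1 * kl_sum u.
have df (u : R) : is_derive u 1 f (kl_slope u).
  have d := is_derive_kl_sum u; rewrite /f.
  by apply: is_derive_eq; rewrite /GRing.scale/=; field.
split.
  exists (c - 2^-1 * (ln 2 + digamma (2^-1 : R))), c => mu sigma sigma0 u.
  have du := is_derive_kummerM (- u); rewrite opprK in du.
  have su := @cvg_digamma_series R u.
  split.
  - by apply/cvg_ex; eexists; exact: su.
  - rewrite KLE// -/u (cvg_lim _ su)//; congr EFin.
    by rewrite expRN; field; rewrite expR_eq0.
  - by case: du.
  - rewrite KLE// -/u derive1E; have [_ ->] := du.
    (* [kl_sum_half_sqr] speaks of half squares, so [u] is put into that form. *)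
    have -> : u = (mu / sigma) ^+ 2 / 2.
      rewrite /u; field; apply: contraTneq sigma0 => ->.
      by rewrite expr0n ltxx.
    by rewrite kl_sum_half_sqr; congr EFin; ring.
exists f; split.
- exact: KLE.
- rewrite KL_slopeE//; apply: cvg_dnbhs_at_right.
  have [d <-] := df 0; move: d => /cvg_ex[l hl].
  rewrite /derive (cvg_lim _ hl)//.
  by move: hl; under eq_fun do rewrite /= scaler1 addr0.
- by move=> u u0; rewrite KL_slopeE ?(ltW u0).
(* The functions are identified only on the closed half-line: for negative [u], [Num.sqrt u] is [0]
   and [KL_slope u] takes the default value of a division by zero. *)
- apply: (@subspace_eq_continuous _ _ _ (@kl_slope R)).
    by move=> u; rewrite inE/= in_itv/= andbT => u0; exact: esym (KL_slopeE u0).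
  exact/continuous_subspaceT/continuous_kl_slope.
Qed.
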